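(* Let $p\in\mathbb{C}[z]$ be a nonconstant polynomial with only simple zeros, let $D_p=\{(x,y,z)\in\mathbb{C}^3 : xy=p(z)\}$, and let $\omega$ be the standard algebraic volume form on $D_p$. Let $\Theta$ be an algebraic volume preserving vector field on $D_p$ and let $f\in\mathbb{C}[D_p]$ be the regular function (unique up to an additive constant) with $i_\Theta\omega=df$. Then $\Theta$ is a Lie combination of locally nilpotent derivations (LNDs) on $D_p$ if and only if, modulo an additive constant, $f$ is of the form $$f(x,y,z)=\sum_{i=1}^{k}\sum_{j=0}^{k'}a_{ij}x^iz^j+\sum_{i=1}^{l}\sum_{j=0}^{l'}b_{ij}y^iz^j+(pq)'(z)$$ (finite sums, $a_{ij},b_{ij}\in\mathbb{C}$) for some polynomial $q\in\mathbb{C}[z]$.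
   Context: $D_p$ is a smooth affine surface. The volume form $\omega$ is the nowhere vanishing algebraic 2-form on $D_p$ (unique up to a constant) given by $\omega=\frac{dx}{x}\wedge dz$ where $x\neq0$ and $\omega=-\frac{dy}{y}\wedge dz$ where $y\neq 0$. A vector field $\Theta$ is volume preserving if $L_\Theta\omega=0$. Here $i_\Theta\omega=\omega(\Theta,\cdot)$ is the interior product; since $D_p$ is simply connected, $\Theta\mapsto f$ with $i_\Theta\omega=df$ is a bijection between algebraic volume preserving vector fields on $D_p$ and regular functions modulo constants. An LND is an algebraic vector field $\Theta$ such that for every $g\in\mathbb{C}[D_p]$ there is an integer $N$ with $\Theta^N(g)=0$ (equivalently, its flow is an algebraic $\mathbb{C}^+$-action). A Lie combination of elements of a set $M$ of vector fields is an element of the (complex) Lie algebra generated by $M$. Prime denotes $d/dz$. *)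

(* Defs.v *)
From HB Require Import structures.
From mathcomp Require Import all_boot all_order all_algebra.
From mathcomp Require Import mpoly complex.
From mathcomp Require Import boolp classical_sets functions reals.
From mathcomp Require Import ring.

Set Implicit Arguments.
Unset Strict Implicit.
Unset Printing Implicit Defensive.

Import GRing.Theory.
Local Open Scope ring_scope.

Section Surface.
Variable C : fieldType.
Implicit Type p : {poly C}.

Record danielewski p := Danielewski {
  ptx : C; pty : C; ptz : C;
  _ : ptx * pty = p.[ptz] }.

Lemma danielewski_eq p (v : danielewski p) : ptx v * pty v = p.[ptz v].
Proof. by case: v. Qed.

HB.instance Definition _ p := gen_eqMixin (danielewski p).
HB.instance Definition _ p := gen_choiceMixin (danielewski p).

Fact danielewski_point_subproof p : 1 * p.[0] = p.[0].
Proof. exact: mul1r. Qed.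

HB.instance Definition _ p := isPointed.Build (danielewski p)
  (Danielewski (danielewski_point_subproof p)).

Definition coords p (v : danielewski p) : 'I_3 -> C :=
  tnth [tuple ptx v; pty v; ptz v].

Definition regular p : {pred danielewski p -> C} := fun f =>
  `[< exists P : {mpoly C[3]}, forall v, f v = P.@[coords v] >].

Fact regular_subring p : subring_closed (@regular p).
Proof.
split; first by apply/asboolP; exists 1 => v; rewrite meval1.
- move=> f g /asboolP[P fP] /asboolP[Q gQ]; apply/asboolP.
  by exists (P - Q) => v; rewrite mevalB -fP -gQ.
- move=> f g /asboolP[P fP] /asboolP[Q gQ]; apply/asboolP.
  by exists (P * Q) => v; rewrite mevalM -fP -gQ.
Qed.

HB.instance Definition _ p :=
  GRing.isSubringClosed.Build _ (@regular p) (regular_subring p).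

(* C[D_p], realised as the functions on D_p that extend to polynomials. *)
Record regfun p := RegFun {
  regfun_val :> danielewski p -> C;
  _ : regfun_val \in @regular p }.

HB.instance Definition _ p := [isSub for @regfun_val p].
HB.instance Definition _ p := [Equality of regfun p by <:].
HB.instance Definition _ p := [Choice of regfun p by <:].
HB.instance Definition _ p :=
  [SubChoice_isSubComNzRing of regfun p by <:].

Fact regfun_scale_subproof p (c : C) (f : regfun p) :
  (fun v => c * f v) \in @regular p.
Proof.
case: f => f /= /asboolP[P fP]; apply/asboolP.
by exists (c *: P) => v; rewrite mevalZ -fP.
Qed.

Definition regfun_scale p (c : C) (f : regfun p) : regfun p :=
  RegFun (regfun_scale_subproof c f).

Fact regfun_scaleA p (a b : C) (f : regfun p) :
  regfun_scale a (regfun_scale b f) = regfun_scale (a * b) f.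
Proof. by apply/val_inj/funext => v; exact: mulrA. Qed.

Fact regfun_scale1 p : left_id 1 (@regfun_scale p).
Proof. by move=> f; apply/val_inj/funext => v; exact: mul1r. Qed.

Fact regfun_scaleDr p : right_distributive (@regfun_scale p) +%R.
Proof. by move=> a f g; apply/val_inj/funext => v; exact: mulrDr. Qed.

Fact regfun_scaleDl p (f : regfun p) :
  {morph (@regfun_scale p)^~ f : a b / a + b}.
Proof. by move=> a b; apply/val_inj/funext => v; exact: mulrDl. Qed.

HB.instance Definition _ p := GRing.Zmodule_isLmodule.Build C (regfun p)
  (@regfun_scaleA p) (@regfun_scale1 p) (@regfun_scaleDr p) (@regfun_scaleDl p).

Fact regfun_scalerAl p (c : C) (f g : regfun p) : c *: (f * g) = c *: f * g.
Proof. by apply/val_inj/funext => v; exact: mulrA. Qed.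

HB.instance Definition _ p :=
  GRing.Lmodule_isLalgebra.Build C (regfun p) (@regfun_scalerAl p).
HB.instance Definition _ p := GRing.Lalgebra_isComAlgebra.Build C (regfun p).

Lemma regfunP p (f g : regfun p) : (forall v, f v = g v) <-> f = g.
Proof. by split=> [fg|->//]; apply/val_inj/funext. Qed.

Fact coord_regular p (i : 'I_3) : (fun v => coords v i) \in @regular p.
Proof. by apply/asboolP; exists 'X_i => v; rewrite mevalXU. Qed.

Definition regx p : regfun p := RegFun (coord_regular p (inord 0)).
Definition regy p : regfun p := RegFun (coord_regular p (inord 1)).
Definition regz p : regfun p := RegFun (coord_regular p (inord 2)).

Lemma regxE p v : regx p v = ptx v.
Proof. by rewrite /= /coords (tnth_nth 0) inordK. Qed.
Lemma regyE p v : regy p v = pty v.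
Proof. by rewrite /= /coords (tnth_nth 0) inordK. Qed.
Lemma regzE p v : regz p v = ptz v.
Proof. by rewrite /= /coords (tnth_nth 0) inordK. Qed.

End Surface.

(* Algebraic vector fields on D_p are the derivations of C[D_p].  They are     *)
(* represented by the underlying maps, which are added and scaled by the       *)
(* pointwise operations on functions.                                          *)
Section VectorFields.
Variables (C : fieldType) (p : {poly C}).
Local Notation A := (regfun p).
Local Open Scope classical_set_scope.

Definition derivation (D : A -> A) : Prop :=
  linear D /\ forall f g, D (f * g) = D f * g + f * D g.

Definition LND (D : A -> A) : Prop :=
  derivation D /\ forall g, exists N : nat, iter N D g = 0.

Definition bracket (D E : A -> A) : A -> A := fun g => D (E g) - E (D g).

Definition lie_closed (S : set (A -> A)) : Prop :=
  [/\ S 0,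
      forall (c : C) D E, S D -> S E -> S (c *: D + E)
    & forall D E, S D -> S E -> S (bracket D E)].

(* The elements of the complex Lie algebra generated by M. *)
Definition lie_combination (M : set (A -> A)) : set (A -> A) :=
  smallest lie_closed M.

(* D_p is smooth and affine, so its algebraic 2-forms are the alternating      *)
(* C[D_p]-bilinear maps on the module of derivations; values outside the set   *)
(* of derivations are irrelevant.  Linearity in the second argument follows    *)
(* by antisymmetry.                                                            *)
Definition two_form (w : (A -> A) -> (A -> A) -> A) : Prop :=
  [/\ forall D E F, derivation D -> derivation E -> derivation F ->
        w (D + E) F = w D F + w E F,
      forall a D E, derivation D -> derivation E ->
        w (fun g => a * D g) E = a * w D E
    & forall D, derivation D -> w D D = 0].

(* (da /\ db)(D, E) = D(a) E(b) - D(b) E(a) *)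
Definition dwedge (a b : A) (D E : A -> A) : A := D a * E b - D b * E a.

(* w = dx/x /\ dz where x <> 0, and w = - dy/y /\ dz where y <> 0; these two   *)
(* open sets are dense in D_p, so this determines w as a 2-form.               *)
Definition standard_volume_form (w : (A -> A) -> (A -> A) -> A) : Prop :=
  two_form w /\
  forall D E, derivation D -> derivation E -> forall v : danielewski p,
    (ptx v != 0 -> w D E v = dwedge (regx p) (regz p) D E v / ptx v) /\
    (pty v != 0 -> w D E v = - (dwedge (regy p) (regz p) D E v / pty v)).

Definition lie_derivative (D : A -> A) (w : (A -> A) -> (A -> A) -> A) :=
  fun E F => D (w E F) - w (bracket D E) F - w E (bracket D F).

Definition volume_preserving (w : (A -> A) -> (A -> A) -> A) (D : A -> A) :
    Prop :=
  forall E F, derivation E -> derivation F -> lie_derivative D w E F = 0.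

(* i_D w = df as 1-forms, with the convention i_D w = w(D, .). *)
Definition hamiltonian (w : (A -> A) -> (A -> A) -> A) (D : A -> A) (f : A) :
    Prop :=
  forall E, derivation E -> w D E = E f.

End VectorFields.

Definition only_simple_zeros (C : fieldType) (p : {poly C}) : Prop :=
  forall a, root p a -> mup a p = 1%N.

Section VolumeForm.
Variables (C : closedFieldType) (p : {poly C}).
Local Notation A := (regfun p).

Lemma derivation_horner_alg (D : A -> A) (a : A) (r : {poly C}) :
  derivation D -> D (horner_alg a r) = horner_alg a r^`() * D a.
Proof.
move=> [Dlin DM].
have D0 : D 0 = 0 by have := Dlin (-1) 0 0; rewrite scaler0 addr0 scaleN1r addNr.
have DD f g : D (f + g) = D f + D g by have := Dlin 1 f g; rewrite !scale1r.
have DZ c f : D (c *: f) = c *: D f by have := Dlin c f 0; rewrite !addr0 D0 addr0.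
have D1 : D 1 = 0.
  by apply: (addrI (D 1)); rewrite addr0 -{3}[1]mulr1 DM mulr1 mul1r.
elim/poly_ind: r => [|r c IHr]; first by rewrite deriv0 !rmorph0 mul0r.
rewrite derivD derivM derivX derivC addr0 mulr1 !rmorphD !rmorphM /=.
rewrite horner_algX horner_algC DD DM DZ D1 scaler0 addr0 IHr.
ring.
Qed.

Lemma horner_algE (r : {poly C}) (a : A) v : horner_alg a r v = r.[a v].
Proof.
elim/poly_ind: r => [|r c IHr]; first by rewrite rmorph0 horner0.
rewrite hornerD hornerM hornerX hornerC -IHr !rmorphD rmorphM /=.
by rewrite horner_algX horner_algC; congr (_ + _); exact: mulr1.
Qed.

Lemma regxy : regx p * regy p = horner_alg (regz p) p.
Proof.
apply/regfunP => v; rewrite horner_algE.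
by rewrite regzE -danielewski_eq -regxE -regyE.
Qed.

Lemma standard_volume_form_exists : p != 0 -> only_simple_zeros p ->
  exists w : (A -> A) -> (A -> A) -> A, standard_volume_form w.
Proof.
move=> p0 ps; have : coprimep p p^`().
  apply: Pdiv.ClosedField.root_coprimep => a pa; apply/negP => /eqP p'a.
  have /factor_theorem[q Ep] := pa.
  have qa : root q a.
    by rewrite /root -p'a Ep derivM derivXsubC !hornerE subrr mulr0 add0r.
  have /factor_theorem[s Eq] := qa.
  suff : (1 < mup a p)%N by rewrite ps.
  by rewrite mup_geq // Ep Eq -mulrA -expr2 dvdp_mull.
move=> /Bezout_eq1_coprimepP[[u v] /= uv].
pose h := horner_alg (regz p).
exists (fun D E => h u * regy p * dwedge (regx p) (regz p) D E
                 + h v * dwedge (regx p) (regy p) D E).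
have huv : h u * (regx p * regy p) + h v * h p^`() = 1.
  by rewrite regxy -!rmorphM -rmorphD uv rmorph1.
have Dp D : derivation D ->
    D (regx p) * regy p + regx p * D (regy p) = h p^`() * D (regz p).
  by move=> DD; rewrite -(derivation_horner_alg _ _ DD) -regxy; case: DD.
split; first split.
- move=> D E F _ _ _; rewrite /dwedge /= !fctE; ring.
- move=> a D E _ _; rewrite /dwedge; ring.
- by move=> D _; rewrite /dwedge; ring.
move=> D E DD DE t; have HD := Dp _ DD; have HE := Dp _ DE.
set w := (X in regfun_val X).
have [wx wy] : dwedge (regx p) (regz p) D E = w * regx p /\
               dwedge (regy p) (regz p) D E = - (w * regy p).
  split; rewrite -[LHS]mul1r -huv /w /dwedge.
    have {}HD : regx p * D (regy p) = h p^`() * D (regz p) - D (regx p) * regy p.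
      by rewrite -HD; ring.
    have {}HE : regx p * E (regy p) = h p^`() * E (regz p) - E (regx p) * regy p.
      by rewrite -HE; ring.
    transitivity (h u * regy p * regx p * (D (regx p) * E (regz p) -
        D (regz p) * E (regx p)) + h v * (D (regx p) * (regx p * E (regy p))
        - (regx p * D (regy p)) * E (regx p))); last by ring.
    by rewrite HD HE; ring.
  have {}HD : regy p * D (regx p) = h p^`() * D (regz p) - D (regy p) * regx p.
    by rewrite -HD; ring.
  have {}HE : regy p * E (regx p) = h p^`() * E (regz p) - E (regy p) * regx p.
    by rewrite -HE; ring.
  transitivity (- (h u * regy p * ((regy p * D (regx p)) * E (regz p) -
      D (regz p) * (regy p * E (regx p))) + h v * ((regy p * D (regx p)) *
      E (regy p) - D (regy p) * (regy p * E (regx p))))); last by ring.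
  by rewrite HD HE; ring.
split => t0.
- by apply: (canRL (mulfK t0)); rewrite -regxE wx.
- by rewrite -mulNr; apply: (canRL (mulfK t0)); rewrite -regyE wy /= opprK.
Qed.

End VolumeForm.

(* Main.v *)
Require Import Defs.
From HB Require Import structures.
From mathcomp Require Import all_boot all_order all_algebra.
From mathcomp Require Import mpoly complex.
From mathcomp Require Import boolp classical_sets functions reals.
From mathcomp Require Import ring zify.

(** Write A for the ring C[D_p] and n for the degree of p.  The form omega is
    dual to the Poisson bracket [ham] on A with
<<
      {z, x} = x,   {z, y} = - y,   {y, x} = p'(z),
>>
    and i_Theta omega = df says that Theta = {f, .} ([hamiltonianE]).  As p has
    simple zeros, u p + v p' = 1 for some u, v, and these give a global formula
    for the bracket.  Passing from f to {f, .} turns brackets of functions into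
    brackets of vector fields and loses only the constants, so everything takes
    place in the Lie algebra A.  Call f admissible if it has the form displayed
    in the theorem; up to constants these are the elements of {A, A}.

    Necessity.  All brackets {f, g} are admissible: since
    {f, gh} = {fh, g} + {fg, h} it is enough to let g be x, y or z
    ([admissible_ham]).  It remains to see that an LND D is {f, .} for an
    admissible f.
    - D is Hamiltonian.  On a surface D{g, h} + k {g, h} = {Dg, h} + {g, Dh}
      for some k in A, the divergence of D.  By Leibniz D + k is nilpotent at
      {z, x} = x, which gives some g <> 0 with Dg = - k g; a locally nilpotent
      D allows this only for k = 0 ([LND_poisson]).  A derivation that
      preserves the bracket is then integrated by means of the grading
      operator {z, .} ([poisson_hamiltonian]).
    - f is admissible ([LND_admissible]).  This is a descent on the Newton
      polygon of f.  Write y^N f = F(y, z) and put y = T^b, z = xi T^c; the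
      coefficient of the top power of T is a polynomial P in xi, the symbol of
      f, and has a weight W.  The symbols of f, g and {f, g} satisfy
      b K = W P Q' - G P' Q ([symbol_ham]).  If W >= c mu, where mu is the
      multiplicity of a root of P or the degree of P, then no iterate of
      {f, .} on y is 0, because the extreme exponent of the symbol can be
      followed through all iterations.  So local nilpotency restricts P, and a
      similar argument starts from x ([root_multiplicity], [degree_from_y],
      [degree_from_x]).  As a consequence the polygon is controlled by the
      pure powers x^i and y^k that occur in f ([vertex_bound]).  Along the edge
      that joins the highest ones, with i <= k, every root of P has a
      multiplicity above half of deg P, so that P = kappa (xi - lambda)^(deg P),
      and an automorphism z |-> z + lambda y^(j+1) removes the top power of y
      ([shear_step]).  The exchange of x and y covers i > k.  At the end no pure
      power of x is left and f is a polynomial in y alone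
      ([no_pure_x_admissible]).  Both kinds of automorphisms preserve
      admissibility ([shear_admissible], [swap_admissible]).

    Sufficiency ([inL_admissible]).  The fields of x^i and y^i are LNDs.  Up to
    nonzero factors, {x^(m+l), y^l} is x^m p^(l-1) p', and bracketing x^m a(z)
    with x^k gives x^(m+k) a'(z).  This yields, for m >= n, functions x^m a(z)
    with a of every degree, hence all of them ([V_full_large]).  For smaller m
    > 0 one descends on m and on the power of p that divides a, since p' is
    invertible modulo p ([V_full]).  Finally (pq)' is {y, x q} ([inL_XY]). *)
Set Implicit Arguments.
Unset Strict Implicit.
Unset Printing Implicit Defensive.

Import Order.TTheory GRing.Theory Num.Theory.
Local Open Scope ring_scope.

(** * Evaluation of bivariate polynomials *)

Section Evaluation.
Variables (C : fieldType) (B : comAlgType C).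
Implicit Types (a b : B) (F G : {poly {poly C}}).

(** The outer variable will play the role of x or y, the inner one that of z. *)
Definition ev a b F : B := (map_poly (horner_alg b) F).[a].

HB.instance Definition _ a b := GRing.RMorphism.copy (ev a b)
  (horner_eval a \o map_poly (horner_alg b)).

Lemma evC a b r : ev a b r%:P = horner_alg b r.
Proof. by rewrite /ev map_polyC hornerC. Qed.

Lemma evX a b : ev a b 'X = a.
Proof. by rewrite /ev map_polyX hornerX. Qed.

Lemma ev0 a b : ev a b 0 = 0. Proof. exact: rmorph0. Qed.
Lemma evD a b F G : ev a b (F + G) = ev a b F + ev a b G.
Proof. exact: rmorphD. Qed.
Lemma evN a b F : ev a b (- F) = - ev a b F. Proof. exact: rmorphN. Qed.
Lemma evB a b F G : ev a b (F - G) = ev a b F - ev a b G.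
Proof. exact: rmorphB. Qed.
Lemma evM a b F G : ev a b (F * G) = ev a b F * ev a b G.
Proof. exact: rmorphM. Qed.

Lemma evXn a b i : ev a b 'X^i = a ^+ i.
Proof. by rewrite rmorphXn /= evX. Qed.

Lemma evE a b F : ev a b F = \sum_(i < size F) a ^+ i * horner_alg b F`_i.
Proof.
rewrite -[in LHS](coefK F) poly_def rmorph_sum /=; apply: eq_bigr => i _.
by rewrite -mul_polyC rmorphM /= evC evXn mulrC.
Qed.
End Evaluation.

Section MPolyGeneration.
Variables (n : nat) (C : comNzRingType).

Lemma mpoly_gen_ind (Pr : {mpoly C[n]} -> Prop) :
  (forall c, Pr c%:MP) -> (forall P Q, Pr P -> Pr Q -> Pr (P + Q)) ->
  (forall i P, Pr P -> Pr ('X_i * P)) -> forall P, Pr P.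
Proof.
move=> PC PD PX; elim/mpolyind => [|c m P _ _ IH]; first exact: PC 0.
apply: (PD) => //; rewrite mpolyXE_id -mul_mpolyC.
elim: {P IH}(index_enum _) => [|i s IH]; first by rewrite big_nil mulr1; exact: PC.
rewrite big_cons mulrCA; elim: (m i) => [|k IHk]; first by rewrite mul1r.
by rewrite exprS -mulrA; exact: PX.
Qed.
End MPolyGeneration.

(** * Iterating operators that satisfy a Leibniz rule *)

Section IteratedDerivations.
Variable A : comNzRingType.

Lemma iter_first_zero (T : A -> A) (w : A) N : w != 0 -> iter N T w = 0 ->
  exists k, iter k T w != 0 /\ iter k.+1 T w = 0.
Proof.
move=> w0; elim: N => [/eqP|N IH TN]; first by rewrite (negbTE w0).
by have [/IH//|N0] := eqVneq (iter N T w) 0; exists N.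
Qed.

Variables (T D : A -> A) (B : A -> A -> A).
Hypothesis TD : {morph T : g h / g + h}.
Hypothesis B0l : forall h, B 0 h = 0.
Hypothesis B0r : forall g, B g 0 = 0.
Hypothesis leibniz : forall g h, T (B g h) = B (D g) h + B g (D h).

Lemma iter_morphD n : {morph iter n T : g h / g + h}.
Proof. by move=> g h; elim: n => //= n ->. Qed.

Lemma iter_morph0 n : iter n T 0 = 0.
Proof. by apply: (addrI (iter n T 0)); rewrite -iter_morphD !addr0. Qed.

(** Here and in the next lemma [T] need not be [D]: for a vector field [D] of
    divergence [k] the Leibniz rule for the Poisson bracket holds with
    [T] = [D] + [k] only. *)
Lemma iter_leibniz_eq0 a b g h : iter a D g = 0 -> iter b D h = 0 ->
  iter (a + b) T (B g h) = 0.
Proof.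
elim/ltn_ind: {a b}(a + b)%N {-2}a {-2}b (erefl (a + b)%N) g h => n IH.
move=> a b; case: a => [|a]; first by move=> _ g h g0 _; rewrite (g0 : g = 0) B0l iter_morph0.
case: b => [|b]; first by move=> _ g h _ h0; rewrite (h0 : h = 0) B0r iter_morph0.
move=> En g h ga hb; rewrite addSn iterSr leibniz iter_morphD.
have E1 : (a + b.+1 < n)%N by rewrite -En.
have E2 : (a.+1 + b < n)%N by rewrite -En; lia.
rewrite (IH _ E1 a b.+1) -?iterSr // add0r.
by rewrite -addSnnS (IH _ E2 a.+1 b) -?iterSr.
Qed.

(** Of the terms of the iterated Leibniz rule only the one that differentiates
    [g] exactly [a] times and [h] exactly [b] times survives. *)
Lemma iter_leibniz_lead a b g h : iter a.+1 D g = 0 -> iter b.+1 D h = 0 ->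
  iter (a + b) T (B g h) = B (iter a D g) (iter b D h) *+ 'C(a + b, a).
Proof.
elim/ltn_ind: {a b}(a + b)%N {-2}a {-2}b (erefl (a + b)%N) g h => n IH.
move=> a b; case: a => [|a].
  move=> _ g h g1 hb {n IH}; rewrite add0n bin0 mulr1n /= in g1 *.
  elim: b h hb => //= b IHb h hb; rewrite -iterS iterSr leibniz g1 B0l add0r.
  by rewrite IHb -?iterSr.
case: b => [|b].
  move=> _ g h ga h1 {n IH}; rewrite addn0 binn mulr1n /= in h1 *.
  elim: a g ga => [|a IHa] g ga.
    by rewrite /= leibniz h1 B0r addr0.
  by rewrite iterSr leibniz h1 B0r addr0 IHa -?iterSr.
move=> En g h ga hb; rewrite addSn iterSr leibniz iter_morphD.
have E1 : (a + b.+1 < n)%N by rewrite -En.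
have E2 : (a.+1 + b < n)%N by rewrite -En; lia.
rewrite (IH _ E1 a b.+1) -?iterSr //.
rewrite -[in X in _ + X]addSnnS (IH _ E2 a.+1 b) -?iterSr //.
by rewrite -mulrnDr addSn addnS binS addnC.
Qed.
End IteratedDerivations.

(** * Polynomials in one variable *)

Lemma poly_antiderivative (C : numFieldType) (a : {poly C}) :
  exists R, R^`() = a.
Proof.
exists (\poly_(i < (size a).+1) (a`_i.-1 / i%:R)); apply/polyP => i.
rewrite coef_deriv coef_poly ltnS /=; case: ltnP => [_|Hi].
  by rewrite -[LHS]mulr_natr divfK ?pnatr_eq0.
by rewrite mul0rn nth_default.
Qed.

Lemma deriv_eq0 (C : numFieldType) (r : {poly C}) : r^`() = 0 -> r = (r`_0)%:P.
Proof.
move=> r0; apply/polyP => -[|i]; rewrite coefC //=.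
have /(congr1 (fun q : {poly C} => q`_i)) := r0.
by rewrite coef_deriv coef0 => /eqP; rewrite mulrn_eq0 /= => /eqP.
Qed.


Lemma horner_alg_taylor (C : comNzRingType) (B : comAlgType C) (a w : B)
    (r : {poly C}) :
  horner_alg (a + w) r = \sum_(m < size r) horner_alg a r^`N(m) * w ^+ m.
Proof.
have E b q : horner_alg b q = (map_poly (in_alg B) q).[b] by [].
rewrite E (nderiv_taylor_wide (n := size r)) ?size_poly //; last exact: mulrC.
by apply: eq_bigr => m _; rewrite E nderivn_map.
Qed.

Lemma dvdp_derivn (C : fieldType) (d F : {poly C}) i m :
  d ^+ i %| F -> d ^+ (i - m) %| F^`(m).
Proof.
move=> dF; elim: m => [|m IH]; first by rewrite subn0 derivn0.
rewrite derivnS subnS; case: (i - m)%N IH => [_|k]; first by rewrite expr0 dvd1p.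
case/dvdpP => q ->; rewrite derivM deriv_exp /= exprS.
apply: dvdp_add; first by rewrite mulrA dvdp_mulIr.
by rewrite -mulr_natr mulrA -mulrA mulrC -!mulrA mulrCA dvdp_mulIl.
Qed.

(** The identity behind [symbol_ham].  With [t] = T^c, [xi] the inner variable
    and [f], [g] the weighted forms of F, G, the elements [df], [dg] stand for
    the weighted forms of the derivatives of F, G in the inner variable, [kf],
    [kg] for those of the Euler derivatives in the outer one, and [tf], [tg]
    for T f_T, T g_T.  The two multiples of [c] cancel. *)
Fact symbol_ring_identity (R : comNzRingType) (t df dg f g kf kg tf tg xi : R)
    (b c m n : nat) :
  kg *+ b = tg - (xi * (t * dg)) *+ c -> kf *+ b = tf - (xi * (t * df)) *+ c ->
  t * ((df * (g *+ m - kg) - (f *+ n - kf) * dg) *+ b)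
  = t * df * (g *+ (b * m) - tg) - (f *+ (b * n) - tf) * (t * dg).
Proof.
move=> Eg Ef; transitivity (t * (df * (g *+ m *+ b - kg *+ b)
  - (f *+ n *+ b - kf *+ b) * dg)); first by ring.
by rewrite Eg Ef; ring.
Qed.

Lemma coef_euler (R : nzRingType) (F : {poly R}) i : ('X * F^`())`_i = F`_i *+ i.
Proof. by rewrite coefXM; case: i => [|i] /=; rewrite ?mulr0n // coef_deriv. Qed.

Lemma coefM_top (R : nzRingType) (F G : {poly R}) k l : (size F <= k.+1)%N -> (size G <= l.+1)%N ->
  (F * G)`_(k + l) = F`_k * G`_l /\ (size (F * G)%R <= (k + l).+1)%N.
Proof.
move=> sF sG; split.
  rewrite coefM (bigD1 (inord k)) //= inordK ?ltnS ?leq_addr // addKn.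
  rewrite big1 ?addr0 // => i /eqP ik; have {}ik : (i : nat) <> k.
    by move=> E; apply: ik; apply/val_inj; rewrite /= inordK ?ltnS ?leq_addr.
  have [ki|ik'] := ltnP k i; first by rewrite [F`_i]nth_default ?mul0r // (leq_trans sF).
  by rewrite [G`__]nth_default ?mulr0 // (leq_trans sG) //; lia.
by apply: (leq_trans (size_polyMleq _ _)); lia.
Qed.

(** * Weighted degrees of bivariate polynomials *)

Section BivariatePolynomials.
Variable C : numFieldType.
Local Notation B := {poly {poly C}}.
Implicit Types (F G s t : B).

Definition bimono (a : C) (k l : nat) : B := (a *: 'X^k)%:P * 'X^l.

Lemma bipoly_ind (Pr : B -> Prop) : (forall F G, Pr F -> Pr G -> Pr (F + G)) ->
  (forall a k l, Pr (bimono a k l)) -> forall F, Pr F.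
Proof.
move=> PD PX F; have P0 : Pr 0.
  by have := PX 0 0%N 0%N; rewrite /bimono scale0r polyC0 mul0r.
rewrite -(coefK F) poly_def; apply: (big_ind Pr P0 PD) => i _.
rewrite -(coefK (F`_i)) poly_def -mul_polyC rmorph_sum mulr_suml /=.
by apply: (big_ind Pr P0 PD) => k _; exact: PX.
Qed.

Definition subst_inner t (r : {poly C}) : B := (map_poly (polyC \o polyC) r).[t].
HB.instance Definition _ t := GRing.RMorphism.copy (subst_inner t)
  (horner_eval t \o map_poly (polyC \o polyC)).

Definition subst s t F : B := (map_poly (subst_inner t) F).[s].
HB.instance Definition _ s t := GRing.RMorphism.copy (subst s t)
  (horner_eval s \o map_poly (subst_inner t)).

Lemma subst_bimono s t a k l : subst s t (bimono a k l) = a%:P%:P * t ^+ k * s ^+ l.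
Proof.
rewrite /subst /bimono rmorphM /= map_polyC map_polyXn hornerM hornerC hornerXn.
congr (_ * _); rewrite /= /subst_inner -mul_polyC rmorphM /= map_polyC map_polyXn.
by rewrite hornerM hornerC hornerXn.
Qed.

Lemma bimonoE a k l : bimono a k l = a%:P%:P * 'X%:P ^+ k * 'X ^+ l.
Proof. by rewrite /bimono -mul_polyC polyCM polyC_exp. Qed.

Definition deriv_inner F : B := map_poly deriv F.

Lemma coef_deriv_inner F i : (deriv_inner F)`_i = (F`_i)^`().
Proof. by rewrite coef_map_id0 // deriv0. Qed.
Lemma deriv_innerD F G : deriv_inner (F + G) = deriv_inner F + deriv_inner G.
Proof. by apply/polyP => i; rewrite coefD !coef_deriv_inner coefD derivD. Qed.

Lemma deriv_inner_bimono a k l : deriv_inner (bimono a k.+1 l) = bimono (a *+ k.+1) k l.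
Proof.
apply/polyP => i; rewrite coef_deriv_inner !coefCM !coefXn.
case: eqP => _; last by rewrite !mulr0 deriv0.
by rewrite !mulr1 derivZ derivXn /= -scalerMnl scalerMnr.
Qed.

Lemma deriv_inner_bimono0 a l : deriv_inner (bimono a 0 l) = 0.
Proof.
apply/polyP => i; rewrite coef_deriv_inner !coefCM !coefXn coef0.
by case: eqP => _; rewrite ?mulr0 ?mulr1 ?deriv0 // derivZ derivC scaler0.
Qed.

Lemma euler_bimono a k l : 'X * (bimono a k l)^`() = bimono a k l *+ l.
Proof.
rewrite /bimono derivM derivC mul0r add0r derivXn.
case: l => [|l] /=; first by rewrite !mulr0n !mulr0.
by rewrite exprS -!mulrnAr; ring.
Qed.

(** To be used for the weighted forms [F], [G], [K] of Laurent polynomials in y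
    that represent two functions and their Poisson bracket; the last hypothesis
    is then the formula of [laurent_ham], with the factor T^c [b] that the
    weights introduce.  Euler operators multiply a top coefficient by its
    exponent, so the top coefficient of [K] depends on those of [F] and [G]
    alone. *)
Lemma coef_top_bracket F G K (b c m m' n n' : nat) : (0 < b)%N -> (c <= m)%N ->
  (size F <= m.+1)%N -> (size G <= m'.+1)%N ->
  'X^c * (K *+ b) = deriv_inner F * (G *+ n' - 'X * G^`())
    - (F *+ n - 'X * F^`()) * deriv_inner G ->
  (size K <= (m + m' - c).+1)%N /\
  K`_(m + m' - c) *+ b = (F`_m * (G`_m')^`()) *~ (m%:Z - n%:Z)
    - ((F`_m)^`() * G`_m') *~ (m'%:Z - n'%:Z).
Proof.
move=> b0 cm sF sG KE.
have size_lin (H : B) k i : (size H <= k.+1)%N -> (size (H *+ i - 'X * H^`())%R <= k.+1)%N.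
  move=> sH; apply/leq_sizeP => r kr; rewrite coefB coefMn coef_euler.
  by rewrite nth_default ?mul0rn ?subr0 // (leq_trans sH).
have size_din (H : B) k : (size H <= k.+1)%N -> (size (deriv_inner H) <= k.+1)%N.
  by move=> sH; apply: leq_trans (size_poly _ _) sH.
have [top1 size1] := coefM_top (size_din _ _ sF) (size_lin _ _ n' sG).
have [top2 size2] := coefM_top (size_lin _ _ n sF) (size_din _ _ sG).
have KX i : (K *+ b)`_i = ('X^c * (K *+ b))`_(i + c).
  by rewrite mulrC coefMXn ltnNge leq_addl /= addnK.
split.
  apply/leq_sizeP => i Hi; have : (K *+ b)`_i = 0.
    rewrite KX KE coefB !nth_default ?subr0 //.
      by apply: (leq_trans size2); lia.
    by apply: (leq_trans size1); lia.
  rewrite coefMn => /polyP E; apply/polyP => k; have := E k.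
  by rewrite coefMn coef0 => /eqP; rewrite mulrn_eq0 -[b == _]negbK -lt0n b0 => /eqP.
rewrite -coefMn KX subnK ?(leq_trans cm) ?leq_addr // KE coefB top1 top2.
rewrite !coefB !coefMn !coef_euler !coef_deriv_inner !mulrzBr -!pmulrn.
by move: (F`_m) (G`_m') => P Q; ring.
Qed.

Section Weight.
Variables b c : nat.
Hypothesis b0 : (0 < b)%N.

(** F(T^b, xi T^c), with T outer and xi inner: the coefficient of T^m is the
    part of F of weight m. *)
Definition wt F : B := subst ('X^b) ('X%:P * 'X^c) F.

Lemma wtD F G : wt (F + G) = wt F + wt G. Proof. exact: rmorphD. Qed.
Lemma wtB F G : wt (F - G) = wt F - wt G. Proof. exact: rmorphB. Qed.
Lemma wtM F G : wt (F * G) = wt F * wt G. Proof. exact: rmorphM. Qed.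
Lemma wt0 : wt 0 = 0. Proof. exact: rmorph0. Qed.
Lemma wtMn F n : wt (F *+ n) = wt F *+ n. Proof. exact: rmorphMn. Qed.

Lemma wt_bimono a k l : wt (bimono a k l) = bimono a k (b * l + c * k).
Proof.
rewrite /wt subst_bimono bimonoE exprMn -!exprM exprD; ring.
Qed.

Lemma wtXn i : wt ('X^i) = 'X^(b * i).
Proof.
have := wt_bimono 1 0 i; rewrite /bimono expr0 scale1r mul1r muln0 addn0 => ->.
by rewrite mul1r.
Qed.

Lemma coef_bimono a k l m : (bimono a k l)`_m = if m == l then a *: 'X^k else 0.
Proof. by rewrite coefCM coefXn; case: eqP; rewrite ?mulr1 ?mulr0. Qed.

(** As [b] is positive, a monomial of F can be recovered from its weight and its
    inner exponent, so [wt] moves coefficients without mixing them. *)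
Lemma coef_wt F l k : (wt F)`_(b * l + c * k)`_k = F`_l`_k.
Proof.
elim/bipoly_ind: F => [F G HF HG|a i j]; first by rewrite wtD !coefD HF HG.
rewrite wt_bimono !coef_bimono; have [<-|ne_lj] := eqVneq l j.
  have [<-|ne_ki] := eqVneq k i; first by rewrite eqxx.
  case: ifP => _; rewrite ?coef0 coefZ coefXn (negbTE ne_ki) mulr0 //.
case: eqP => [E|_]; last by rewrite coef0.
have [ki|ne_ki] := eqVneq k i; last by rewrite coefZ coefXn (negbTE ne_ki) mulr0 coef0.
move/eqP: E; rewrite ki eqn_add2r eqn_pmul2l // => /eqP lj.
by rewrite lj eqxx in ne_lj.
Qed.

Lemma coef_wt_neq0 F m k : (wt F)`_m`_k != 0 ->
  exists l, m = (b * l + c * k)%N /\ F`_l`_k != 0.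
Proof.
move=> Fmk; suff [l El] : exists l, m = (b * l + c * k)%N.
  by exists l; split=> //; rewrite -coef_wt -El.
apply: contrapT => no_l; move/eqP: Fmk; apply.
elim/bipoly_ind: F => [F G HF HG|a i j].
  by rewrite wtD !coefD HF HG addr0.
rewrite wt_bimono coef_bimono; case: eqP => [E|_]; last by rewrite coef0.
rewrite coefZ coefXn; case: eqP => [ki|_]; last by rewrite mulr0.
by case: no_l; exists j; rewrite E ki.
Qed.

Lemma size_wt F m : (forall l k, F`_l`_k != 0 -> (b * l + c * k <= m)%N) ->
  (size (wt F) <= m.+1)%N.
Proof.
move=> Fm; apply/leq_sizeP => i mi; apply/polyP => k; rewrite coef0; apply/eqP.
apply: contraLR mi => /coef_wt_neq0[l [-> /Fm]]; by rewrite -leqNgt.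
Qed.

Lemma coef_le_size_wt F l k : F`_l`_k != 0 -> (b * l + c * k <= (size (wt F)).-1)%N.
Proof.
move=> Flk; have : (b * l + c * k < size (wt F))%N; last by case: size.
by rewrite ltnNge; apply: contra_neqN Flk => le; rewrite -(coef_wt F) [(wt F)`_ _]nth_default ?coef0.
Qed.

Lemma wt_eq0 F : wt F = 0 -> F = 0.
Proof.
move=> F0; apply/polyP => l; apply/polyP => k.
by rewrite -coef_wt F0 !coef0.
Qed.

Lemma wt_deriv_inner F : 'X^c * wt (deriv_inner F) = deriv_inner (wt F).
Proof.
elim/bipoly_ind: F => [F G HF HG|a k l].
  by rewrite deriv_innerD !wtD deriv_innerD mulrDr HF HG.
rewrite wt_bimono; case: k => [|k]; first by rewrite !deriv_inner_bimono0 wt0 mulr0.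
by rewrite !deriv_inner_bimono wt_bimono !bimonoE mulnS addnA addnAC !exprD; ring.
Qed.

(** T d/dT is the Euler field of the weights, b Y d/dY + c Z d/dZ. *)
Lemma wt_euler F : wt ('X * F^`()) *+ b
  = 'X * (wt F)^`() - ('X%:P * deriv_inner (wt F)) *+ c.
Proof.
elim/bipoly_ind: F => [F G HF HG|a k l].
  rewrite derivD mulrDr !wtD mulrnDl HF HG derivD deriv_innerD; ring.
rewrite euler_bimono wtMn !wt_bimono euler_bimono; case: k => [|k].
  by rewrite deriv_inner_bimono0 muln0 addn0 mulr0 mul0rn subr0 -mulrnA mulnC.
rewrite deriv_inner_bimono !bimonoE; set s := 'X ^+ (_ + _).
rewrite polyCMn polyCMn exprS; ring.
Qed.
End Weight.

Lemma subst_comp s t s' t' F :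
  subst s t (subst s' t' F) = subst (subst s t s') (subst s t t') F.
Proof.
have sC a : subst s t a%:P%:P = a%:P%:P.
  have := subst_bimono s t a 0 0; rewrite bimonoE !expr0 !mulr1; exact.
elim/bipoly_ind: F => [F G HF HG|a k l]; first by rewrite !rmorphD /= HF HG.
by rewrite !subst_bimono !rmorphM !rmorphXn /= sC.
Qed.
(** For c = b (j+1) the term l y^(j+1) has the weight of z, hence the
    substitution is homogeneous and acts on every weighted part by
    xi |-> xi + l. *)
Lemma wt_shift b c j (l : C) F m : c = (b * j.+1)%N ->
  (wt b c (subst 'X ('X%:P + l%:P%:P * 'X^(j.+1)) F))`_m
  = (wt b c F)`_m \Po ('X + l%:P).
Proof.
move=> cE; suff -> : wt b c (subst 'X ('X%:P + l%:P%:P * 'X^(j.+1)) F)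
    = map_poly (comp_poly ('X + l%:P)) (wt b c F) by rewrite coef_map.
rewrite /wt subst_comp.
have sC s t a : subst s t a%:P%:P = a%:P%:P.
  have := subst_bimono s t a 0 0; rewrite bimonoE !expr0 !mulr1; exact.
have sX s t : subst s t 'X = s.
  have := subst_bimono s t 1 0 1; rewrite bimonoE !expr0 !expr1 !mulr1 !mul1r; exact.
have sZ s t : subst s t 'X%:P = t.
  have := subst_bimono s t 1 1 0; rewrite bimonoE !expr0 !expr1 !mulr1 !mul1r; exact.
rewrite sX rmorphD rmorphM rmorphXn /= sX sZ sC.
elim/bipoly_ind: F => [F G HF HG|a k i].
  by rewrite !rmorphD /= HF HG.
rewrite !subst_bimono !rmorphM !rmorphXn /= !map_polyC /= comp_polyC map_polyX.
congr (_ * _ ^+ _ * _); rewrite rmorphM rmorphXn /= map_polyC map_polyX /=.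
by rewrite comp_polyX polyCD -exprM -cE; ring.
Qed.
End BivariatePolynomials.
#[global] Opaque wt.

(** * The bracket of two symbols *)

Section OneVariableSteps.
Variable C : numFieldType.
Implicit Types P Q K : {poly C}.

(** The leading terms c X^(d+1) of [P] and e X^q of [Q] contribute
    (W q - G (d+1)) c e X^(q+d), and nothing else reaches this degree. *)
Lemma degree_step P Q K (W G : int) (b d q : nat) : (0 < b)%N ->
  size P = d.+2 -> size Q = q.+1 ->
  K *+ b = (P * Q^`()) *~ W - (P^`() * Q) *~ G ->
  W * q%:Z - G * d.+1%:Z != 0 -> size K = (q + d).+1.
Proof.
move=> b0 sP sQ KE WG.
have XE : 'X * (K *+ b) = (P * ('X * Q^`())) *~ W - ('X * P^`() * Q) *~ G.
  by rewrite KE; ring.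
have s_euler (H : {poly C}) k : size H = k.+1 -> (size ('X * H^`())%R <= k.+1)%N.
  move=> sH; apply/leq_sizeP => i ki.
  by rewrite coef_euler nth_default ?mul0rn // sH.
have sP' : (size P <= d.+2)%N by rewrite sP.
have sQ' : (size Q <= q.+1)%N by rewrite sQ.
have [top1 size1] := coefM_top sP' (s_euler _ _ sQ).
have [top2 size2] := coefM_top (s_euler _ _ sP) sQ'.
have KX i : K`_i *+ b = (P * ('X * Q^`()))`_i.+1 *~ W - ('X * P^`() * Q)`_i.+1 *~ G.
  by rewrite -!coefMrz -coefB -XE coefXM coefMn.
apply/eqP; rewrite eqn_leq; apply/andP; split.
  apply/leq_sizeP => i Hi; apply/eqP; have /eqP := KX i.
  rewrite [(P * _)`_ _]nth_default; last by apply: (leq_trans size1); lia.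
  rewrite [('X * _ * _)`_ _]nth_default; last by apply: (leq_trans size2); lia.
  by rewrite !mul0rz subrr mulrn_eq0 -[b == _]negbK -lt0n b0.
rewrite ltnNge; apply: contraNN WG => sK; have := KX (q + d)%N.
rewrite [K`__]nth_default // mul0rn -addnS addnC top1 top2 !coef_euler.
have -> : P`_d.+1 = lead_coef P by rewrite lead_coefE sP.
have -> : Q`_q = lead_coef Q by rewrite lead_coefE sQ.
have P0 : lead_coef P != 0 by rewrite lead_coef_eq0 -size_poly_eq0 sP.
have Q0 : lead_coef Q != 0 by rewrite lead_coef_eq0 -size_poly_eq0 sQ.
move=> /esym E; have : (W * q%:Z - G * d.+1%:Z)%:~R * (lead_coef P * lead_coef Q) = 0.
  by rewrite -E rmorphB !rmorphM /= !pmulrn; ring.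
by move/eqP; rewrite !mulf_eq0 (negbTE P0) (negbTE Q0) !orbF intr_eq0.
Qed.

(** The same computation with lowest terms in powers of X - a. *)
Lemma root_step P Q K (W G : int) (b d q : nat) a : (0 < b)%N ->
  (exists2 P1, P = ('X - a%:P) ^+ d.+1 * P1 & P1.[a] != 0) ->
  (exists2 Q1, Q = ('X - a%:P) ^+ q * Q1 & Q1.[a] != 0) ->
  K *+ b = (P * Q^`()) *~ W - (P^`() * Q) *~ G ->
  W * q%:Z - G * d.+1%:Z != 0 ->
  exists2 K1, K = ('X - a%:P) ^+ (q + d) * K1 & K1.[a] != 0.
Proof.
move=> b0 [P1 PE P1a] [Q1 QE Q1a] KE WG; set t := 'X - a%:P in PE QE *.
have t0 : t != 0 by rewrite polyXsubC_eq0.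
have dexp (H : {poly C}) i : (t ^+ i * H)^`() * t = t ^+ i * (H *+ i + t * H^`()).
  rewrite derivM deriv_exp derivXsubC mul1r mulrDl mulrnAl.
  case: i => [|i] /=; first by rewrite !mulr0n mul0r !add0r; ring.
  by rewrite !exprS; ring.
pose K2 := (P1 * (Q1 *+ q + t * Q1^`())) *~ W
  - ((P1 *+ d.+1 + t * P1^`()) * Q1) *~ G.
have KE2 : K *+ b = t ^+ (q + d) * K2.
  apply: (mulIf t0); rewrite KE.
  transitivity ((P * (Q^`() * t)) *~ W - (P^`() * t * Q) *~ G); first by ring.
  by rewrite PE QE !dexp /K2 exprD exprS; ring.
exists (b%:R^-1 *: K2).
  rewrite -scalerAr -KE2 -scaler_nat scalerA mulVf ?scale1r //.
  by rewrite pnatr_eq0 -lt0n.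
rewrite hornerZ mulf_neq0 ?invr_eq0 ?pnatr_eq0 -?lt0n //.
have -> : K2.[a] = (W * q%:Z - G * d.+1%:Z)%:~R * (P1.[a] * Q1.[a]).
  rewrite /K2 hornerD hornerN !hornerMz !hornerM !hornerD !hornerMn !hornerM.
  rewrite /t hornerXsubC subrr !mul0r !addr0 rmorphB !rmorphM /=; ring.
by rewrite !mulf_neq0 // intr_eq0.
Qed.
End OneVariableSteps.

Section SingleRoot.
Variable C : closedFieldType.
Implicit Type P : {poly C}.

Lemma root_factor P a : P != 0 -> root P a ->
  exists d, exists2 P1, P = ('X - a%:P) ^+ d.+1 * P1 & P1.[a] != 0.
Proof.
move=> P0 Pa; have [d [q + PE]] := multiplicity_XsubC P a; rewrite P0 /= => qa.
case: d PE => [|d] PE; last by exists d; exists q; rewrite // mulrC.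
by rewrite PE mulr1 in Pa; rewrite Pa in qa.
Qed.

(** A second root would make the multiplicities add up to more than the
    degree. *)
Lemma single_root P s : size P = s.+1 -> (0 < s)%N ->
  (forall a d, (exists2 P1, P = ('X - a%:P) ^+ d.+1 * P1 & P1.[a] != 0) ->
    (s < d.+1.*2)%N) ->
  exists a k, k != 0 /\ P = k *: ('X - a%:P) ^+ s.
Proof.
move=> sP s0 mult; have P0 : P != 0 by rewrite -size_poly_eq0 sP.
have [|a Pa] := closed_rootP P _; first by rewrite sP; lia.
have [d [P1 PE P1a]] := root_factor P0 Pa; exists a.
have P10 : P1 != 0 by apply: contraNneq P1a => ->; rewrite horner0.
have sE : (s = d.+1 + (size P1).-1)%N.
  have : size P = (d.+1 + size P1)%N.
    by rewrite PE mulrC size_Mmonic ?rpredX ?monicXsubC // size_exp_XsubC addnS addnC.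
  by have : (0 < size P1)%N; [rewrite size_poly_gt0|rewrite sP; lia].
have [s1|s1] := eqVneq (size P1) 1%N.
  have /size_poly1P[k k0 P1k] : size P1 == 1%N by rewrite s1.
  exists k; split=> //; rewrite PE P1k mulrC mul_polyC; congr (_ *: _ ^+ _); lia.
have [a' P1a'] := closed_rootP P1 s1.
have [d' [P2 P1E P2a']] := root_factor P10 P1a'.
have aa' : a' != a by apply: contraNneq P1a => <-; exact: P1a'.
have P20 : P2 != 0 by apply: contraNneq P2a' => ->; rewrite horner0.
have sE' : size P1 = (d'.+1 + size P2)%N.
  by rewrite P1E mulrC size_Mmonic ?rpredX ?monicXsubC // size_exp_XsubC addnS addnC.
have m1 : (s < d.+1.*2)%N by apply: (mult a); exists P1.
have m2 : (s < d'.+1.*2)%N.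
  apply: (mult a'); exists (('X - a%:P) ^+ d.+1 * P2); first by rewrite PE P1E mulrCA.
  by rewrite hornerM horner_exp hornerXsubC mulf_neq0 // expf_neq0 // subr_eq0.
by have : (0 < size P2)%N; [rewrite size_poly_gt0|lia].
Qed.
End SingleRoot.

Lemma size_deriv_char0 (C : numFieldType) (r : {poly C}) :
  size r^`() = (size r).-1.
Proof.
have [r1|r1] := leqP (size r) 1.
  rewrite (size1_polyC r1) derivC size_poly0 size_polyC.
  by case: eqP.
apply/eqP; rewrite eqn_leq; apply/andP; split.
  rewrite -ltnS (ltn_predK r1); apply: lt_size_deriv.
  by rewrite -size_poly_gt0 ltnW.
rewrite -[X in (X <= _)%N](prednK (n := (size r).-1)); last by rewrite -ltnS (ltn_predK r1).
rewrite ltnNge; apply/negP => le; have : r^`()`_(size r).-2 == 0 by rewrite nth_default.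
rewrite coef_deriv prednK; last by rewrite -ltnS (ltn_predK r1).
rewrite mulrn_eq0 -lead_coefE lead_coef_eq0 -size_poly_eq0.
by case: (size r) r1 => [|[|k]].
Qed.

Lemma size_derivn (C : numFieldType) (r : {poly C}) k :
  size r^`(k) = (size r - k)%N.
Proof.
elim: k => [|k IH]; first by rewrite subn0.
by rewrite derivnS size_deriv_char0 IH subnS.
Qed.

(** Elimination of leading coefficients. *)
Lemma poly_subspace_full (C : fieldType) (S : {poly C} -> Prop) :
  S 0 -> (forall c a b, S a -> S b -> S (c *: a + b)) ->
  (forall d, exists2 a, S a & size a = d.+1) -> forall r, S r.
Proof.
move=> S0 Slin Ssize r; have [d] := ubnP (size r).
elim: d r => // d IH r; rewrite ltnS leq_eqVlt => /orP[/eqP sr|]; last exact: IH.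
case: d IH sr => [|d] IH sr; first by move/eqP: sr; rewrite size_poly_eq0 => /eqP ->.
have [a Sa sa] := Ssize d; pose k := lead_coef r / lead_coef a.
have a0 : lead_coef a != 0 by rewrite lead_coef_eq0 -size_poly_eq0 sa.
rewrite -[r](subrK (k *: a)) addrC; apply: Slin => //; apply: IH.
rewrite ltnS; apply/leq_sizeP => i; rewrite leq_eqVlt => /orP[/eqP <-|di].
  rewrite coefB coefZ.
  have -> : r`_d = lead_coef r by rewrite lead_coefE sr.
  have -> : a`_d = lead_coef a by rewrite lead_coefE sa.
  by rewrite /k divfK // subrr.
by rewrite coefB coefZ !nth_default ?mulr0 ?subrr // ?sa ?sr.
Qed.

(** * Functions on the surface and their normal form *)

Section DanielewskiSurface.
Variables (C : numClosedFieldType) (p bu bv : {poly C}).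
Hypothesis p_nonconst : (1 < size p)%N.
Hypothesis bezout_p : bu * p + bv * p^`() = 1.
Local Notation A := (regfun p).
Local Notation x := (regx p).
Local Notation y := (regy p).
Local Notation z := (regz p).
Local Notation pz := (horner_alg (regz p)).
Local Notation n := (size p).-1.

Lemma p_neq0 : p != 0.
Proof. by rewrite -size_poly_gt0 ltnW. Qed.

Local Notation M := {mpoly C[3]}.
Local Notation i0 := (inord 0 : 'I_3).
Local Notation i1 := (inord 1 : 'I_3).
Local Notation i2 := (inord 2 : 'I_3).

Fact regpoly_subproof (P : M) : (fun v => P.@[coords v]) \in @regular C p.
Proof. by apply/asboolP; exists P. Qed.

Definition regpoly (P : M) : A := RegFun (regpoly_subproof P).

Lemma regpolyP (f : A) : exists P, f = regpoly P.
Proof.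
case: f => f fP; have /asboolP[P fE] := fP; exists P.
by apply/regfunP => v; rewrite /= fE.
Qed.

Fact regpoly_zmod : zmod_morphism regpoly.
Proof. by move=> P Q; apply/regfunP => v; rewrite /= mevalB. Qed.
Fact regpoly_monoid : monoid_morphism regpoly.
Proof.
by split=> [|P Q]; apply/regfunP => v; rewrite /= ?mevalM // meval1.
Qed.
Fact regpoly_scalable : scalable regpoly.
Proof. by move=> c P; apply/regfunP => v; rewrite /= mevalZ. Qed.

HB.instance Definition _ := GRing.isZmodMorphism.Build M A regpoly regpoly_zmod.
HB.instance Definition _ :=
  GRing.isMonoidMorphism.Build M A regpoly regpoly_monoid.
HB.instance Definition _ :=
  GRing.isScalable.Build C M A _ regpoly regpoly_scalable.

Lemma regpolyX : regpoly 'X_i0 = regx p.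
Proof. by apply/regfunP => v; rewrite /= mevalXU. Qed.
Lemma regpolyY : regpoly 'X_i1 = regy p.
Proof. by apply/regfunP => v; rewrite /= mevalXU. Qed.
Lemma regpolyZ : regpoly 'X_i2 = regz p.
Proof. by apply/regfunP => v; rewrite /= mevalXU. Qed.

Lemma ord3P (Pr : 'I_3 -> Prop) : Pr i0 -> Pr i1 -> Pr i2 -> forall i, Pr i.
Proof.
move=> P0 P1 P2 [[|[|[|//]]] Hi].
- by rewrite (_ : Ordinal _ = i0) //; apply/val_inj; rewrite /= inordK.
- by rewrite (_ : Ordinal _ = i1) //; apply/val_inj; rewrite /= inordK.
- by rewrite (_ : Ordinal _ = i2) //; apply/val_inj; rewrite /= inordK.
Qed.

Lemma regfun_ind (Pr : A -> Prop) :
  (forall c, Pr c%:A) -> (forall f g, Pr f -> Pr g -> Pr (f + g)) ->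
  (forall f g, Pr f -> Pr g -> Pr (f * g)) ->
  Pr (regx p) -> Pr (regy p) -> Pr (regz p) -> forall f, Pr f.
Proof.
move=> PC PD PM Px Py Pz f; have [P ->] := regpolyP f.
elim/mpoly_gen_ind: P => [c|P Q|].
- by rewrite -alg_mpolyC linearZ /= rmorph1; exact: PC.
- by rewrite rmorphD /=; exact: PD.
by apply: ord3P => P; rewrite rmorphM /=; rewrite ?regpolyX ?regpolyY ?regpolyZ;
  exact: PM.
Qed.

Lemma horner_alg_regpoly (r : {poly C}) (P : M) :
  regpoly (horner_alg P r) = horner_alg (regpoly P) r.
Proof.
elim/poly_ind: r => [|r c IH]; first by rewrite !rmorph0.
rewrite !rmorphD !rmorphM /= !horner_algX !horner_algC IH.
by rewrite linearZ /= rmorph1.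
Qed.

Lemma ev_regpoly (P Q : M) (F : {poly {poly C}}) :
  regpoly (ev P Q F) = ev (regpoly P) (regpoly Q) F.
Proof.
rewrite !evE rmorph_sum /=; apply: eq_bigr => i _.
by rewrite rmorphM rmorphXn /= horner_alg_regpoly.
Qed.

Definition surface_eq : M := 'X_i0 * 'X_i1 - horner_alg 'X_i2 p.

(** The relation x y = p(z) eliminates all monomials that contain both x and
    y. *)
Lemma mpoly_nf (P : M) : exists S U V, P = surface_eq * S
  + ev 'X_i0 'X_i2 U + 'X_i1 * ev 'X_i1 'X_i2 V.
Proof.
have hM r : horner_alg ('X_i2 : M) r = ev 'X_i0 'X_i2 r%:P by rewrite evC.
have hM1 r : horner_alg ('X_i2 : M) r = ev 'X_i1 'X_i2 r%:P by rewrite evC.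
elim/mpoly_gen_ind: P => [c|P Q|].
- exists 0, (c%:P%:P), 0; rewrite evC horner_algC alg_mpolyC rmorph0; ring.
- move=> [S1 [U1 [V1 ->]]] [S2 [U2 [V2 ->]]].
  by exists (S1 + S2), (U1 + U2), (V1 + V2); rewrite !rmorphD /=; ring.
have split1 (V : {poly {poly C}}) : exists r W, V = r%:P + 'X * W.
  by elim/poly_ind: V => [|V r _]; [exists 0, 0; rewrite mulr0 addr0
    | exists r, V; rewrite mulrC addrC].
apply: ord3P => P [S [U [V ->]]].
(* x y V(y, z), with V = r(z) + y W: one factor y is cancelled at the cost of p. *)
- have [r [W ->]] := split1 V.
  exists ('X_i0 * S + ev 'X_i1 'X_i2 (r%:P + 'X * W)),
    ('X * U + (p * r)%:P), (p%:P * W).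
  rewrite !rmorphD !rmorphM /= !evX !evC /surface_eq; ring.
- have [r [W ->]] := split1 U.
  exists ('X_i1 * S + ev 'X_i0 'X_i2 W), (p%:P * W), (r%:P + 'X * V).
  rewrite !rmorphD !rmorphM /= !evX !evC /surface_eq; ring.
- exists ('X_i2 * S), ('X%:P * U), ('X%:P * V).
  rewrite !rmorphM /= !evC horner_algX; ring.
Qed.

Lemma regpolyM (P Q : M) : regpoly (P * Q) = regpoly P * regpoly Q.
Proof. exact: rmorphM. Qed.
Lemma regpolyB (P Q : M) : regpoly (P - Q) = regpoly P - regpoly Q.
Proof. exact: rmorphB. Qed.
Lemma regpolyD (P Q : M) : regpoly (P + Q) = regpoly P + regpoly Q.
Proof. exact: rmorphD. Qed.

Lemma regpoly_surface_eq : regpoly surface_eq = 0.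
Proof.
rewrite regpolyB regpolyM regpolyX regpolyY.
by rewrite horner_alg_regpoly regpolyZ regxy subrr.
Qed.

(** The second summand carries a factor y, so that a polynomial in z alone has
    only one place; the coefficient of y^(e+1) is therefore V`_e. *)
Lemma regfun_nf (f : A) : exists U V,
  f = ev (regx p) (regz p) U + regy p * ev (regy p) (regz p) V.
Proof.
have [P ->] := regpolyP f; have [S [U [V ->]]] := mpoly_nf P.
exists U, V; rewrite 2!regpolyD !regpolyM regpoly_surface_eq mul0r add0r.
by rewrite !ev_regpoly regpolyX regpolyY regpolyZ.
Qed.

Lemma poly_eq0_pointwise (q : {poly C}) : (forall t, q.[t] = 0) -> q = 0.
Proof.
move=> q0; apply: (@roots_geq_poly_eq0 _ _ [seq i%:R | i <- iota 0 (size q)]).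
- by apply/allP => t _; apply/rootP.
- by rewrite map_inj_uniq ?iota_uniq //; exact: mulrIn (oner_neq0 _).
- by rewrite size_map size_iota.
Qed.

Lemma poly_eq0_dense (q r : {poly C}) : r != 0 ->
  (forall t, r.[t] != 0 -> q.[t] = 0) -> q = 0.
Proof.
move=> r0 qr; apply/eqP; rewrite -[_ == _]orbF -(negbTE r0) -mulf_eq0.
apply/eqP/poly_eq0_pointwise => t; rewrite hornerM.
by have [->|/qr ->] := eqVneq r.[t] 0; rewrite ?mulr0 ?mul0r.
Qed.

Lemma regfunDE (f g : A) v : (f + g) v = f v + g v. Proof. by []. Qed.
Lemma regfunME (f g : A) v : (f * g) v = f v * g v. Proof. by []. Qed.
Lemma regfunXE (f : A) i v : (f ^+ i) v = f v ^+ i.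
Proof. by elim: i => // i IH; rewrite !exprS regfunME IH. Qed.
Lemma regfun_sumE (I : Type) (s : seq I) (F : I -> A) v :
  (\sum_(i <- s) F i) v = \sum_(i <- s) F i v.
Proof. by elim/big_rec2: _ => // i a f _ <-. Qed.

Lemma ev_val (a b : A) F v : (ev a b F) v = F.[(a v)%:P].[b v].
Proof.
rewrite evE regfun_sumE [F.[_]]horner_coef horner_sum; apply: eq_bigr => i _.
by rewrite regfunME regfunXE horner_algE hornerM -polyC_exp hornerC mulrC.
Qed.


(** Fix z = t with p(t) <> 0.  Then y = p(t) / s for x = s <> 0, and the
    function times s^(size V) is a polynomial in s, with the coefficients of U in
    the upper half and those of V, times powers of p(t), in the lower one. *)
Lemma nf_eq0_torus U V : (forall v, ptx v != 0 -> pty v != 0 ->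
    (ev (regx p) (regz p) U + regy p * ev (regy p) (regz p) V) v = 0) ->
  U = 0 /\ V = 0.
Proof.
move=> UV0; pose N := size V.
have G0 t : p.[t] != 0 -> map_poly (horner_eval t) U * 'X^N +
    \poly_(k < N) (p.[t] ^+ (N - k) * (V`_(N.-1 - k)).[t]) = 0.
  move=> pt; apply: (@poly_eq0_dense _ 'X); first by rewrite polyX_eq0.
  move=> s; rewrite hornerX => s0.
  have vP : s * (p.[t] / s) = p.[t] by rewrite mulrCA mulfV ?mulr1.
  have yv : pty (Danielewski vP) != 0 by rewrite /= mulf_neq0 ?invr_eq0.
  have := UV0 (Danielewski vP) s0 yv.
  rewrite regfunDE regfunME !ev_val regxE regyE regzE /=.
  move/(congr1 ( *%R^~ (s ^+ N))); rewrite mul0r => <-.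
  rewrite hornerD hornerM hornerXn mulrDl; congr (_ * _ + _).
    by rewrite -{1}(hornerC s t); exact: (horner_map (horner_eval t)).
  rewrite horner_poly [V.[_]]horner_coef horner_sum mulr_sumr mulr_suml.
  rewrite (reindex_inj rev_ord_inj) /=; apply: eq_bigr => i _.
  rewrite subKn ?ltn_ord // (_ : (N.-1 - (N - i.+1)) = i)%N; last first.
    by have := ltn_ord i; rewrite -/N; lia.
  rewrite hornerM -polyC_exp hornerC exprMn exprVn.
  have -> : s ^+ N = s ^+ (N - i.+1) * s * s ^+ i.
    by rewrite -mulrA -exprS -exprD subnK ?ltn_ord.
  by rewrite exprS; field; rewrite expf_neq0.
have Vi0 i : V`_i = 0.
  have [Hi|Hi] := leqP N i; first by rewrite nth_default.
  apply: poly_eq0_dense p_neq0 _ => t pt.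
  have /(congr1 (fun q : {poly C} => q`_(N.-1 - i))) := G0 t pt.
  rewrite coefD coefMXn coef_poly coef0 (_ : N.-1 - i < N)%N; last by lia.
  rewrite add0r (_ : N.-1 - (N.-1 - i) = i)%N; last by lia.
  by move/eqP; rewrite mulf_eq0 expf_eq0 (negbTE pt) andbF => /eqP.
have V0 : V = 0 by apply/polyP => i; rewrite Vi0 coef0.
split=> //; apply/polyP => i; rewrite coef0; apply: poly_eq0_dense p_neq0 _ => t pt.
have /(congr1 (fun q : {poly C} => q`_(i + N))) := G0 t pt.
rewrite coefD coefMXn coef_poly coef0 ltnNge leq_addl /= addr0 addnK.
by rewrite coef_map.
Qed.

Lemma nf_eq0 U V :
  ev (regx p) (regz p) U + regy p * ev (regy p) (regz p) V = 0 ->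
  U = 0 /\ V = 0.
Proof. by move=> E; apply: nf_eq0_torus => v _ _; rewrite E. Qed.

(** Density of the torus x y <> 0; the standard volume form is given by formulas
    that hold there. *)
Lemma regfun_eq0_torus (f : A) :
  (forall v, ptx v != 0 -> pty v != 0 -> f v = 0) -> f = 0.
Proof.
have [U [V ->]] := regfun_nf f; move/nf_eq0_torus => [-> ->].
by rewrite !rmorph0 mulr0 addr0.
Qed.

(** y^N f is a polynomial in y and z, since x = p(z) / y. *)
Lemma laurent_exists (f : A) : exists N F, regy p ^+ N * f = ev (regy p) (regz p) F.
Proof.
elim/regfun_ind: f => [c|f g [N [F fE]] [M' [G gE]]|f g [N [F fE]] [M' [G gE]]|||].
- exists 0%N, c%:P%:P; rewrite evC horner_algC; ring.
- exists (N + M')%N, ('X^M' * F + 'X^N * G).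
  by rewrite rmorphD !rmorphM /= !evXn -fE -gE exprD; ring.
- by exists (N + M')%N, (F * G); rewrite rmorphM /= -fE -gE exprD; ring.
- by exists 1%N, p%:P; rewrite evC expr1 mulrC regxy.
- by exists 0%N, 'X; rewrite evX; ring.
- by exists 0%N, 'X%:P; rewrite evC horner_algX; ring.
Qed.

Lemma ev_eq0 F : ev (regy p) (regz p) F = 0 -> F = 0.
Proof.
move=> F0; have : 'X * F = 0.
  apply: (@nf_eq0 0 ('X * F) _).2.
  by rewrite rmorph0 rmorphM /= F0 !mulr0 addr0.
by move/eqP; rewrite mulf_eq0 polyX_eq0 => /eqP.
Qed.

(** D_p is irreducible: A embeds into the Laurent polynomials in y over
    C[z]. *)
Lemma regfun_mul_eq0 (f g : A) : f * g = 0 -> f = 0 \/ g = 0.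
Proof.
have [N [F fE]] := laurent_exists f; have [K [G gE]] := laurent_exists g.
move=> fg0; have : F * G = 0.
  by apply: ev_eq0; rewrite rmorphM /= -fE -gE mulrACA fg0 mulr0.
have aux h L : regy p ^+ L * h = 0 -> h = 0 :> A.
  move=> yh; apply: regfun_eq0_torus => v _ yv.
  have /regfunP/(_ v) := yh; rewrite regfunME regfunXE regyE => /eqP.
  by rewrite mulf_eq0 expf_eq0 (negbTE yv) andbF => /eqP.
move/eqP; rewrite mulf_eq0 => /orP[/eqP F0|/eqP G0]; [left|right].
- by apply: (aux _ N); rewrite fE F0 rmorph0.
- by apply: (aux _ K); rewrite gE G0 rmorph0.
Qed.

Lemma regfun_mulfI (f g h : A) : f != 0 -> f * g = f * h -> g = h.
Proof.
move=> /eqP f0 /eqP; rewrite -subr_eq0 -mulrBr => /eqP/regfun_mul_eq0[//|].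
by move/eqP; rewrite subr_eq0 => /eqP.
Qed.

Lemma regx_neq0 : regx p != 0.
Proof.
apply/eqP => x0; suff /eqP : ('X : {poly {poly C}}) = 0 by rewrite polyX_eq0.
by apply: (@nf_eq0 'X 0 _).1; rewrite evX rmorph0 x0 mulr0 addr0.
Qed.

Lemma regy_neq0 : regy p != 0.
Proof.
apply/eqP => y0; suff /eqP : ('X : {poly {poly C}}) = 0 by rewrite polyX_eq0.
by apply: ev_eq0; rewrite evX.
Qed.

Lemma regfun_exp_neq0 (f : A) i : f != 0 -> f ^+ i != 0.
Proof.
move=> f0; elim: i => [|i IH]; first by rewrite expr0 oner_neq0.
by apply/eqP; rewrite exprS => /regfun_mul_eq0[]; apply/eqP.
Qed.

(** * Derivations and endomorphisms of the coordinate ring *)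

Implicit Types (D E : A -> A) (f g : A).

Section OneDerivation.
Variables (D : A -> A) (DD : derivation D).

Lemma derM f g : D (f * g) = D f * g + f * D g. Proof. exact: DD.2. Qed.
Lemma der_lin c f g : D (c *: f + g) = c *: D f + D g. Proof. exact: DD.1. Qed.
Lemma derD f g : D (f + g) = D f + D g.
Proof. by have := der_lin 1 f g; rewrite !scale1r. Qed.
Lemma der0 : D 0 = 0.
Proof. by apply: (addrI (D 0)); rewrite -derD !addr0. Qed.
Lemma derZ c f : D (c *: f) = c *: D f.
Proof. by have := der_lin c f 0; rewrite !addr0 der0 addr0. Qed.
Lemma derN f : D (- f) = - D f.
Proof. by rewrite -scaleN1r derZ scaleN1r. Qed.
Lemma derB f g : D (f - g) = D f - D g.
Proof. by rewrite derD derN. Qed.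
Lemma der1 : D 1 = 0.
Proof. by apply: (addrI (D 1)); rewrite addr0 -{3}[1]mulr1 derM mulr1 mul1r. Qed.
Lemma derC c : D c%:A = 0.
Proof. by rewrite derZ der1 scaler0. Qed.
Lemma derX f i : D (f ^+ i) = (f ^+ i.-1 * D f) *+ i.
Proof.
elim: i => [|i IH]; first by rewrite expr0 der1 mulr0n.
rewrite exprS derM IH mulrS [D f * _]mulrC mulrnAr mulrA; congr (_ + _).
by case: i {IH} => [|i] //=; rewrite -exprS.
Qed.
Lemma der_pol (a : A) r : D (horner_alg a r) = horner_alg a r^`() * D a.
Proof. exact: derivation_horner_alg. Qed.
End OneDerivation.

Lemma der_add D E : derivation D -> derivation E -> derivation (D + E).
Proof.
have aE f : (D + E) f = D f + E f by [].
move=> DD DE; split=> [c f g|f g]; rewrite !aE.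
  by rewrite (der_lin DD) (der_lin DE) scalerDr addrACA.
by rewrite (derM DD) (derM DE); ring.
Qed.

Lemma der_scale D a : derivation D -> derivation (fun g => a * D g).
Proof.
move=> DD; split=> [c f g|f g]; first by rewrite (der_lin DD) mulrDr scalerAr.
by rewrite (derM DD); ring.
Qed.

Lemma der_bracket D E : derivation D -> derivation E -> derivation (bracket D E).
Proof.
move=> DD DE; split=> [c f g|f g]; rewrite /bracket.
  by rewrite (der_lin DE) (der_lin DD) (der_lin DD) (der_lin DE) scalerBr; ring.
by rewrite !(derM DE, derM DD, derD DE, derD DD); ring.
Qed.

Lemma der_ext D E : derivation D -> derivation E ->
  D x = E x -> D y = E y -> D z = E z -> D = E.
Proof.
move=> DD DE ex ey ez; apply/funext; elim/regfun_ind => [c|f g Hf Hg|f g Hf Hg|||] //.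
- by rewrite !derC.
- by rewrite (derD DD) (derD DE) Hf Hg.
- by rewrite (derM DD) (derM DE) Hf Hg.
Qed.

Lemma regpolyS k (P : M) : regpoly (k *: P) = k *: regpoly P.
Proof. exact: linearZ. Qed.

(** x y - p(z) generates the ideal of the surface.  This makes [regpoly] a
    presentation of A, from which derivations can be defined. *)
Lemma regpoly_eq0 (P : M) : regpoly P = 0 -> exists S, P = surface_eq * S.
Proof.
have [S [U [V ->]]] := mpoly_nf P.
rewrite 2!regpolyD !regpolyM regpoly_surface_eq mul0r add0r !ev_regpoly.
rewrite regpolyX regpolyY regpolyZ => /nf_eq0[-> ->].
by exists S; rewrite !rmorph0 mulr0 !addr0.
Qed.

Lemma mderiv_horner_alg i (P : M) (r : {poly C}) :
  mderiv i (horner_alg P r) = horner_alg P r^`() * mderiv i P.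
Proof.
elim/poly_ind: r => [|r c IH]; first by rewrite deriv0 !rmorph0 mderiv0 mul0r.
rewrite derivD derivM derivX derivC addr0 mulr1 !rmorphD !rmorphM /=.
rewrite horner_algX horner_algC mderivD mderivM alg_mpolyC mderivC addr0 IH; ring.
Qed.

Lemma mderivXU i j : mderiv i ('X_j : M) = (i == j)%:R.
Proof.
rewrite mderivX mnm1E eq_sym; case: eqP => [->|_]; last by rewrite scale0r.
by rewrite scale1r -[U_(j)%MM in X in (X - _)%MM]add0m addmK mpolyX0.
Qed.

(** The values at x, y, z may be prescribed subject to the derivative of the
    relation x y = p(z). *)
Lemma derivation_exists (a b c : A) : a * y + x * b = pz p^`() * c ->
  exists D, [/\ derivation D, D x = a, D y = b & D z = c].
Proof.
move=> abc.
(* The derivation along (a, b, c) on polynomials, with values in A.  It kills the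
   ideal of the surface, hence does not depend on the representative. *)
pose T (P : M) := regpoly (mderiv i0 P) * a + regpoly (mderiv i1 P) * b
  + regpoly (mderiv i2 P) * c.
have TB P Q : T (P - Q) = T P - T Q.
  by rewrite /T !mderivB !regpolyB; ring.
have TM P Q : T (P * Q) = T P * regpoly Q + regpoly P * T Q.
  by rewrite /T !mderivM !regpolyD !regpolyM; ring.
have E01 : (i0 == i1) = false by apply/eqP => /(congr1 val); rewrite /= !inordK.
have E02 : (i0 == i2) = false by apply/eqP => /(congr1 val); rewrite /= !inordK.
have E12 : (i1 == i2) = false by apply/eqP => /(congr1 val); rewrite /= !inordK.
have r0 : regpoly 0 = 0 by exact: rmorph0.
have r1 : regpoly 1 = 1 by exact: rmorph1.
have TX : T 'X_i0 = a.
  by rewrite /T !mderivXU eqxx ![_ == i0]eq_sym E01 E02 r0 r1; ring.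
have TY : T 'X_i1 = b.
  by rewrite /T !mderivXU eqxx E01 [i2 == _]eq_sym E12 r0 r1; ring.
have TZ : T 'X_i2 = c.
  by rewrite /T !mderivXU eqxx E02 E12 r0 r1; ring.
have T0 P : regpoly P = 0 -> T P = 0.
  move=> /regpoly_eq0[S ->]; rewrite TM regpoly_surface_eq mul0r addr0 TB TM.
  rewrite TX TY regpolyX regpolyY abc /T !mderiv_horner_alg !mderivXU eqxx E02 E12.
  by rewrite !regpolyM r0 r1 horner_alg_regpoly regpolyZ; ring.
have Teq P Q : regpoly P = regpoly Q -> T P = T Q.
  by move=> PQ; apply/eqP; rewrite -subr_eq0 -TB T0 // regpolyB PQ subrr.
pose rep (f : A) : M := projT1 (cid (regpolyP f)).
have repP f : regpoly (rep f) = f by rewrite /rep; case: cid.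
have TR P : T (rep (regpoly P)) = T P by apply: Teq.
exists (fun f => T (rep f)); split.
- split=> [k f g|f g].
    have -> : T (rep (k *: f + g)) = T (k *: rep f - (0 - rep g)).
      apply: Teq; rewrite repP !regpolyB !repP r0.
      by rewrite regpolyS repP; ring.
    rewrite !TB [T 0]T0 // sub0r opprK; congr (_ + _).
    by rewrite /T !mderivZ !regpolyS !scalerDr !scalerAl.
  have -> : T (rep (f * g)) = T (rep f * rep g).
    by apply: Teq; rewrite regpolyM !repP.
  by rewrite TM !repP.
- by rewrite -regpolyX TR.
- by rewrite -regpolyY TR.
- by rewrite -regpolyZ TR.
Qed.

Section Endomorphism.
Variables (a b c : A) (abc : a * b = horner_alg c p).

Fact endo_point_subproof v : a v * b v = p.[c v].
Proof. by rewrite -horner_algE -abc. Qed.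

Fact endo_subproof (f : A) :
  (fun v => f (Danielewski (endo_point_subproof v))) \in @regular C p.
Proof.
have [P fP] := regpolyP f; have [Pa aP] := regpolyP a.
have [Pb bP] := regpolyP b; have [Pc cP] := regpolyP c.
apply/asboolP; exists (P \mPo [tuple Pa; Pb; Pc]) => v.
rewrite comp_mpoly_meval fP /=; apply: meval_eq.
apply: ord3P; rewrite /coords !(tnth_nth 0) !inordK //=.
- by rewrite aP.
- by rewrite bP.
- by rewrite cP.
Qed.

(** Composition with the self-map (a, b, c) of the surface. *)
Definition endo (f : A) : A := RegFun (endo_subproof f).

Fact endo_zmod : zmod_morphism endo.
Proof. by move=> f g; apply/regfunP. Qed.
Fact endo_monoid : monoid_morphism endo.
Proof. by split=> [|f g]; apply/regfunP. Qed.
Fact endo_scalable : scalable endo.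
Proof. by move=> k f; apply/regfunP. Qed.

HB.instance Definition _ := GRing.isZmodMorphism.Build A A endo endo_zmod.
HB.instance Definition _ := GRing.isMonoidMorphism.Build A A endo endo_monoid.
HB.instance Definition _ := GRing.isScalable.Build C A A _ endo endo_scalable.

Lemma endo_x : endo x = a. Proof. by apply/regfunP => v; rewrite -[LHS]/(x _) regxE. Qed.
Lemma endo_y : endo y = b. Proof. by apply/regfunP => v; rewrite -[LHS]/(y _) regyE. Qed.
Lemma endo_z : endo z = c. Proof. by apply/regfunP => v; rewrite -[LHS]/(z _) regzE. Qed.

End Endomorphism.

(** * The Poisson bracket *)

Fact dx_subproof : 0 * y + x * pz p^`() = pz p^`() * x.
Proof. by ring. Qed.
Fact dy_subproof : pz p^`() * y + x * 0 = pz p^`() * y.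
Proof. by ring. Qed.
Fact dz_subproof : x * y + x * (- y) = pz p^`() * 0.
Proof. by ring. Qed.

(** These will be the fields f |-> {f, x}, {y, f} and {z, f}; together they span
    the tangent spaces of the surface. *)
Definition dx := projT1 (cid (derivation_exists dx_subproof)).
Definition dy := projT1 (cid (derivation_exists dy_subproof)).
Definition dz := projT1 (cid (derivation_exists dz_subproof)).

Lemma dxP : [/\ derivation dx, dx x = 0, dx y = pz p^`() & dx z = x].
Proof. by rewrite /dx; case: cid. Qed.
Lemma dyP : [/\ derivation dy, dy x = pz p^`(), dy y = 0 & dy z = y].
Proof. by rewrite /dy; case: cid. Qed.
Lemma dzP : [/\ derivation dz, dz x = x, dz y = - y & dz z = 0].
Proof. by rewrite /dz; case: cid. Qed.

Lemma ddx : derivation dx. Proof. by case: dxP. Qed.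
Lemma ddy : derivation dy. Proof. by case: dyP. Qed.
Lemma ddz : derivation dz. Proof. by case: dzP. Qed.
Lemma dxx : dx x = 0. Proof. by case: dxP. Qed.
Lemma dxy : dx y = pz p^`(). Proof. by case: dxP. Qed.
Lemma dxz : dx z = x. Proof. by case: dxP. Qed.
Lemma dyx : dy x = pz p^`(). Proof. by case: dyP. Qed.
Lemma dyy : dy y = 0. Proof. by case: dyP. Qed.
Lemma dyz : dy z = y. Proof. by case: dyP. Qed.
Lemma dzx : dz x = x. Proof. by case: dzP. Qed.
Lemma dzy : dz y = - y. Proof. by case: dzP. Qed.
Lemma dzz : dz z = 0. Proof. by case: dzP. Qed.
Definition dE := (dxx, dxy, dxz, dyx, dyy, dyz, dzx, dzy, dzz).

(** On y <> 0 the bracket is (f_y g_z - f_z g_y) y, in terms of the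
    fields (dy f dz g - dz f dy g) / y; near y = 0 one has p' <> 0 and may divide
    by p' instead.  The Bezout relation u p + v p' = 1 glues the two formulas
    into one with values in A. *)
Definition ham (f g : A) : A :=
  pz bu * x * (dy f * dz g - dz f * dy g) + pz bv * (dx f * dy g - dy f * dx g).

Lemma scale_pz c (f : A) : c *: f = pz c%:P * f.
Proof. by rewrite horner_algC mulr_algl. Qed.

Lemma ham_anti f g : ham f g = - ham g f.
Proof. by rewrite /ham; ring. Qed.

Lemma ham_self f : ham f f = 0.
Proof. by rewrite /ham; ring. Qed.

Lemma ham_der f : derivation (ham f).
Proof.
split=> [c g h|g h]; rewrite /ham.
  rewrite !(der_lin ddx, der_lin ddy, der_lin ddz).
  by rewrite !scale_pz; ring.
by rewrite !(derM ddx, derM ddy, derM ddz); ring.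
Qed.

Lemma ham_derl g : derivation (ham^~ g).
Proof.
have E : ham^~ g = (fun f => (-1) * ham g f).
  by apply/funext => f; rewrite ham_anti mulN1r.
by rewrite E; apply: der_scale; exact: ham_der.
Qed.

Lemma bezout_z : pz bu * (x * y) + pz bv * pz p^`() = 1.
Proof. by rewrite regxy -!rmorphM -rmorphD /= bezout_p rmorph1. Qed.

Lemma ham_zx : ham z x = x.
Proof. by rewrite /ham !dE -[RHS]mulr1 -bezout_z; ring. Qed.
Lemma ham_zy : ham z y = - y.
Proof. by rewrite /ham !dE -[RHS]mulr1 -bezout_z; ring. Qed.
Lemma ham_yx : ham y x = pz p^`().
Proof. by rewrite /ham !dE -[RHS]mulr1 -bezout_z; ring. Qed.

Lemma ham_x f : ham f x = dx f.
Proof.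
suff E : ham^~ x = dx by exact: (congr1 (@^~ f) E).
by apply: (der_ext (ham_derl x) ddx); rewrite !dE ?ham_zx ?ham_yx ?ham_self.
Qed.
Lemma ham_y f : ham f y = - dy f.
Proof.
rewrite -mulN1r; suff E : ham^~ y = (fun f => -1 * dy f) by exact: (congr1 (@^~ f) E).
apply: (der_ext (ham_derl y) (der_scale _ ddy)).
- by rewrite ham_anti ham_yx dyx mulN1r.
- by rewrite ham_self dyy mulr0.
- by rewrite ham_zy dyz mulN1r.
Qed.
Lemma ham_z f : ham f z = - dz f.
Proof.
rewrite -mulN1r; suff E : ham^~ z = (fun f => -1 * dz f) by exact: (congr1 (@^~ f) E).
apply: (der_ext (ham_derl z) (der_scale _ ddz)).
- by rewrite ham_anti ham_zx dzx mulN1r.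
- by rewrite ham_anti ham_zy dzy mulN1r.
- by rewrite ham_self dzz mulr0.
Qed.
Lemma ham_of_x f : ham x f = - dx f. Proof. by rewrite ham_anti ham_x. Qed.
Lemma ham_of_y f : ham y f = dy f. Proof. by rewrite ham_anti ham_y opprK. Qed.
Lemma ham_of_z f : ham z f = dz f. Proof. by rewrite ham_anti ham_z opprK. Qed.

(** On y <> 0 the surface has the coordinates y and z, with dy z = y and
    dz y = - y; all fields are combinations of [dy] and [dz]
    there. *)
Lemma y_der E g : derivation E -> y * E g = E z * dy g - E y * dz g.
Proof.
move=> DE; pose F h := E z * dy h + (- E y) * dz h.
transitivity (F g); last by rewrite /F; ring.
suff EF : (fun h => y * E h) = F by exact: (congr1 (@^~ g) EF).
apply: der_ext; first exact: der_scale.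
- exact: (der_add (der_scale _ ddy) (der_scale _ ddz)).
- rewrite /F !dE; have /(congr1 E) := regxy p.
  rewrite (derM DE) (der_pol DE) => H.
  by transitivity (E x * y + x * E y - x * E y); [|rewrite H]; ring.
- by rewrite /F !dE; ring.
- by rewrite /F !dE; ring.
Qed.

(** A surface carries only one bivector up to functions, so an alternating
    biderivation is determined by its value at (y, z); the factor [y] on the left
    is {y, z}.  The divergence, the Jacobi identity and the effect of automorphisms on
    the bracket are all obtained from this lemma. *)
Lemma biderivation_ham (K : A -> A -> A) : (forall f, derivation (K f)) ->
  (forall f g, K f g = - K g f) -> forall f g, K f g * y = ham f g * K y z.
Proof.
(* On y <> 0 a biderivation is its value at (y, z) times the Jacobian. *)
have key L : (forall f, derivation (L f)) -> (forall f g, L f g = - L g f) ->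
    forall f g, y * (y * L f g) = L y z * (dy f * dz g - dz f * dy g).
  move=> DL Lanti f g; have Lself h : L h h = 0.
    apply/eqP; have /eqP := Lanti h h; rewrite -addr_eq0 -mulr2n -mulr_natl.
    move/eqP/(congr1 (fun a : A => 2^-1 *: a)); rewrite scaler0 mulr_natl.
    by rewrite -scaler_nat scalerA mulVf ?pnatr_eq0 // scale1r => ->.
  rewrite (y_der g (DL f)) mulrBr !mulrA [L f z]Lanti [L f y]Lanti.
  rewrite !mulrN (y_der f (DL z)) (y_der f (DL y)) !Lself [L z y]Lanti; ring.
move=> DK Kanti f g.
apply: (regfun_mulfI regy_neq0).
apply: (regfun_mulfI regy_neq0).
have := key K DK Kanti f g; have := key ham ham_der ham_anti f g.
rewrite ham_of_y dyz => EJ EK.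
transitivity (y * (y * K f g) * y); first by ring.
rewrite EK; transitivity (K y z * (y * (y * ham f g))); first by rewrite EJ; ring.
by ring.
Qed.

(** The negative of the Lie derivative of the Poisson bivector: the divergence
    of [D] times the bracket. *)
Definition bracket_defect (D : A -> A) (g h : A) : A := ham (D g) h + ham g (D h) - D (ham g h).

Lemma defect_biderivation D : derivation D ->
  (forall f, derivation (bracket_defect D f)) /\
  (forall f g, bracket_defect D f g = - bracket_defect D g f).
Proof.
move=> DD; split=> [f|f g]; last first.
  rewrite /bracket_defect [ham (D f) g]ham_anti [ham f (D g)]ham_anti [ham f g]ham_anti (derN DD).
  by ring.
split=> [c g h|g h]; rewrite /bracket_defect.
  rewrite (der_lin DD) !(der_lin (ham_der _)) (der_lin DD).
  by rewrite !scale_pz; ring.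
by rewrite (derM DD) (derD (ham_der _)) !(derM (ham_der _)) (derD DD) !(derM DD); ring.
Qed.

Lemma bracket_dz_dy f : dz (dy f) - dy (dz f) = - dy f.
Proof.
rewrite -[in RHS]mulN1r.
suff E : bracket dz dy = (fun f => -1 * dy f) by exact: (congr1 (@^~ f) E).
apply: (der_ext (der_bracket ddz ddy) (der_scale _ ddy));
  rewrite /bracket !dE ?(der_pol ddz) ?(derN ddy) ?dE ?(der0 ddz) ?(der0 ddy); ring.
Qed.

(** The defect of [ham f] is an alternating biderivation, so only its value at
    (y, z) has to be computed. *)
Lemma jacobi f g h : ham f (ham g h) = ham (ham f g) h + ham g (ham f h).
Proof.
have [DK Kanti] := defect_biderivation (ham_der f).
have K0 : bracket_defect (ham f) y z = 0.
  rewrite /bracket_defect (ham_y f) (ham_z f) ham_of_y ham_of_y dyz.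
  rewrite ham_z (derN ddz) (derN ddy) (ham_y f).
  transitivity ((dz (dy f) - dy (dz f)) + dy f); first by ring.
  by rewrite bracket_dz_dy addNr.
have := biderivation_ham DK Kanti g h.
rewrite K0 mulr0 mulrC => /regfun_mul_eq0[/eqP|/eqP].
  by rewrite (negbTE regy_neq0).
by rewrite /bracket_defect subr_eq0 => /eqP ->.
Qed.

Lemma ham_bracket f g : ham (ham f g) = bracket (ham f) (ham g).
Proof. by apply/funext => h; rewrite /bracket jacobi; ring. Qed.

(** * Hamiltonian fields and the volume form *)

Section VolumeForm.
Variables (omega : (A -> A) -> (A -> A) -> A).
Hypothesis omega_std : standard_volume_form omega.

Lemma omega_x D E : derivation D -> derivation E ->
  x * omega D E = dwedge x z D E.
Proof.
move=> DD DE; apply/eqP; rewrite -subr_eq0; apply/eqP.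
apply: regfun_eq0_torus => w xw yw.
have [/(_ xw) Ew _] := omega_std.2 D E DD DE w.
rewrite -[LHS]/((x * omega D E) w - dwedge x z D E w) regfunME Ew regxE.
by rewrite mulrCA mulfV // mulr1 subrr.
Qed.

Lemma omega_y D E : derivation D -> derivation E ->
  y * omega D E = - dwedge y z D E.
Proof.
move=> DD DE; apply/eqP; rewrite -addr_eq0; apply/eqP.
apply: regfun_eq0_torus => w xw yw.
have [_ /(_ yw) Ew] := omega_std.2 D E DD DE w.
rewrite -[LHS]/((y * omega D E) w + dwedge y z D E w) regfunME Ew regyE.
by rewrite mulrN mulrCA mulfV // mulr1 addNr.
Qed.

Lemma hamiltonianE D f : derivation D -> hamiltonian omega D f -> D = ham f.
Proof.
move=> DD Hf; apply: (der_ext DD (ham_der f)).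
- rewrite ham_x -(Hf _ ddx).
  apply: (regfun_mulfI regx_neq0).
  by rewrite (omega_x DD ddx) /dwedge !dE; ring.
- rewrite ham_y -(Hf _ ddy).
  apply: (regfun_mulfI regy_neq0).
  by rewrite mulrN (omega_y DD ddy) /dwedge !dE; ring.
- rewrite ham_z -(Hf _ ddz).
  apply: (regfun_mulfI regx_neq0).
  by rewrite mulrN (omega_x DD ddz) /dwedge !dE; ring.
Qed.
End VolumeForm.

(** * Locally nilpotent derivations are Hamiltonian *)

Lemma regfun_mulrn_eq0 (f : A) n : f *+ n.+1 = 0 -> f = 0.
Proof.
move/(congr1 (fun a : A => n.+1%:R^-1 *: a)).
by rewrite scaler0 -scaler_nat scalerA mulVf ?pnatr_eq0 // scale1r.
Qed.

(** The defect K of [D] is a multiple of the bracket, with factor K(y, z) / y.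
    The Bezout relation shows this quotient to be regular, as K(z, x) / x and
    K(y, x) / p' are other expressions for it. *)
Lemma divergence_exists D : derivation D -> exists k, forall g h,
  D (ham g h) + k * ham g h = ham (D g) h + ham g (D h).
Proof.
move=> DD; have [DK Kanti] := defect_biderivation DD.
have KJ := biderivation_ham DK Kanti.
set K := bracket_defect D in DK Kanti KJ.
pose k := pz bu * y * K z x + pz bv * K y x; exists k => g h.
suff /eqP : K g h = k * ham g h.
  by rewrite /K /bracket_defect subr_eq => /eqP ->; ring.
apply: (regfun_mulfI regy_neq0).
rewrite mulrC KJ /k.
transitivity ((pz bu * y * (K z x * y) + pz bv * (K y x * y)) * ham g h); last by ring.
rewrite (KJ z x) (KJ y x) ham_zx ham_yx.
transitivity ((pz bu * (x * y) + pz bv * pz p^`()) * (K y z * ham g h)); last by ring.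
by rewrite bezout_z; ring.
Qed.

(** The operator T = D + k obeys the Leibniz rule for the bracket and [D], and
    so it is nilpotent at {z, x} = x.  The last nonzero T^j x is a g with
    Dg = - k g.  Now the degrees of g and k with respect to the locally nilpotent
    [D] add up in g k, while Dg has a smaller degree than g. *)
Lemma LND_poisson D : LND D -> forall g h, D (ham g h) = ham (D g) h + ham g (D h).
Proof.
move=> [DD Dnil]; have [k Hk] := divergence_exists DD.
suff k0 : k = 0 by move=> g h; rewrite -Hk k0 mul0r addr0.
pose T a := D a + k * a.
have TD : {morph T : g h / g + h} by move=> g h; rewrite /T (derD DD); ring.
have [a za] := Dnil z; have [b xb] := Dnil x.
have B0l h : ham 0 h = 0 by exact: (der0 (ham_derl h)).
have B0r g : ham g 0 = 0 by exact: (der0 (ham_der g)).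
have := iter_leibniz_eq0 TD B0l B0r Hk za xb.
rewrite ham_zx => /(iter_first_zero regx_neq0)[j [gj0 /= Tg]].
set g := iter j T x in gj0 Tg.
have [//|k0] := eqVneq k 0.
have [N gN] := Dnil g; have [c [gc0 gc]] := iter_first_zero gj0 gN.
have [N' kN] := Dnil k; have [d [kd0 kd]] := iter_first_zero k0 kN.
have := iter_leibniz_lead (derD DD) (@mul0r A) (@mulr0 A) (derM DD) gc kd.
have -> : g * k = - D g.
  by apply/eqP; rewrite -addr_eq0 addrC mulrC; apply/eqP.
have DN n f : iter n D (- f) = - iter n D f.
  by elim: n => //= n ->; rewrite (derN DD).
rewrite DN -iterSr -addSn addnC iterD gc.
have -> n : iter n D 0 = 0 by elim: n => //= n ->; rewrite (der0 DD).
rewrite oppr0 => /esym.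
have : (0 < 'C(c + d, c))%N by rewrite bin_gt0 leq_addr.
case: 'C(_, _) => // m _ /regfun_mulrn_eq0/(regfun_mul_eq0)[]/eqP.
  by rewrite (negbTE gc0).
by rewrite (negbTE kd0).
Qed.

Lemma der_ev D (a b : A) F : derivation D ->
  D (ev a b F) = ev a b F^`() * D a + ev a b (map_poly deriv F) * D b.
Proof.
move=> DD; elim/poly_ind: F => [|F r IH].
  by rewrite deriv0 map_poly0 !rmorph0 (der0 DD); ring.
rewrite derivD derivM derivX derivC addr0 mulr1.
have -> : map_poly deriv (F * 'X + r%:P) = map_poly deriv F * 'X + r^`()%:P.
  apply/polyP => i; rewrite !(coef_map_id0, coefD, coefMX, coefC) ?deriv0 //.
  by rewrite derivD; case: i => [|i]; rewrite /= ?coef_map_id0 ?deriv0.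
rewrite !(evD, evM, evX, evC) (derD DD) (derM DD) (der_pol DD) IH.
by ring.
Qed.

Lemma regfun_span (Pr : A -> Prop) : Pr 0 ->
  (forall f g, Pr f -> Pr g -> Pr (f + g)) ->
  (forall i r, Pr (x ^+ i * pz r)) -> (forall i r, Pr (y ^+ i.+1 * pz r)) ->
  forall f, Pr f.
Proof.
move=> P0 PD Px Py f; have [U [V ->]] := regfun_nf f.
apply: (PD); rewrite evE ?mulr_sumr.
  by apply: (big_ind Pr); [exact: P0|exact: PD|move=> i _; exact: Px].
apply: (big_ind Pr); [exact: P0|exact: PD|move=> i _].
by rewrite mulrA -exprS; exact: Py.
Qed.

Lemma dz_x i r : dz (x ^+ i * pz r) = (x ^+ i * pz r) *+ i.
Proof.
rewrite (derM ddz) (derX ddz) (der_pol ddz) !dE mulr0 mulr0 addr0.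
by case: i => [|i]; rewrite ?mulr0n ?mul0r //= -exprSr mulrnAl.
Qed.

Lemma dz_y i r : dz (y ^+ i * pz r) = - (y ^+ i * pz r) *+ i.
Proof.
rewrite (derM ddz) (derX ddz) (der_pol ddz) !dE mulr0 mulr0 addr0.
by case: i => [|i]; rewrite ?mulr0n ?mul0r //= mulrN -exprSr mulrnAl mulNr.
Qed.

(** [dz] has the eigenspaces x^i C[z] for i and y^i C[z] for - i, hence misses
    only the kernel C[z]. *)
Lemma dz_image g : exists h r, g = dz h + pz r.
Proof.
elim/regfun_span: g => [|f g [h [r ->]] [k [s ->]]|i r|i r].
- by exists 0, 0; rewrite (der0 ddz) rmorph0 addr0.
- by exists (h + k), (r + s); rewrite (derD ddz) rmorphD /=; ring.
- case: i => [|i]; first by exists 0, r; rewrite (der0 ddz) add0r mul1r.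
  exists (i.+1%:R^-1 *: (x ^+ i.+1 * pz r)), 0.
  rewrite (derZ ddz) dz_x rmorph0 addr0 -scaler_nat scalerA.
  by rewrite mulVf ?pnatr_eq0 // scale1r.
- exists (- (i.+1%:R^-1 *: (y ^+ i.+1 * pz r))), 0.
  rewrite (derN ddz) (derZ ddz) dz_y rmorph0 addr0 mulNrn scalerN opprK.
  by rewrite -scaler_nat scalerA mulVf ?pnatr_eq0 // scale1r.
Qed.

(** Comparing the eigencomponents of both sides.  Used for c = 0, 1 and -1. *)
Lemma dz_eigen c g r : dz g = c *: g + pz r -> exists U V,
  [/\ g = ev x z U + y * ev y z V,
      forall i, (i%:R - c) *: U`_i = (if i == 0%N then r else 0)
    & forall i, (i.+1%:R + c) *: V`_i = 0].
Proof.
have [U [V gE]] := regfun_nf g; move=> Hg; exists U, V.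
have : ev x z ('X * U^`() - c%:P%:P * U - r%:P)
     + y * ev y z (- V - 'X * V^`() - c%:P%:P * V) = 0.
  rewrite !(evB, evN, evM, evX, evC).
  transitivity (dz g - (c *: g + pz r)); last by rewrite Hg subrr.
  rewrite gE (derD ddz) (derM ddz) !(der_ev _ _ _ ddz) !dE scale_pz; ring.
move/(nf_eq0) => [U0 V0]; split=> // i.
  have /(congr1 (fun F : {poly {poly C}} => F`_i)) := U0.
  rewrite !coefB coefXM coefC coefCM coef0 => /eqP; rewrite subr_eq0 => /eqP <-.
  by case: i => [|i] /=; rewrite ?coef_deriv -?scaler_nat -mul_polyC
    ?scalerBl -?mul_polyC ?scale0r; ring.
have /(congr1 (fun F : {poly {poly C}} => F`_i)) := V0.
rewrite !coefB coefN coefXM coefCM coef0 => E; rewrite -[RHS]oppr0 -[X in _ = - X]E {E}.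
by case: i => [|i] /=; rewrite ?coef_deriv -mul_polyC polyCD polyC_natr; ring.
Qed.

Lemma pz_eq0 r : pz r = 0 :> A -> r = 0.
Proof.
rewrite -(evC y z) => /ev_eq0/eqP; rewrite polyC_eq0 => /eqP; exact.
Qed.

(** Adding a Hamiltonian field gives E z = r(z) in C[z] ([dz_image]).  Applying
    E to {z, x} = x and {z, y} = - y shows first that r' = 0 and then that E x
    and E y are eigenvectors of [dz], E x = x a(z) and E y = y b(z).  The relation
    x y = p(z) becomes p (a + b) = p' r, which by degrees forces r = 0 and
    b = - a.  Such an E is the field of an antiderivative of a. *)
Lemma poisson_hamiltonian D : derivation D ->
  (forall g h, D (ham g h) = ham (D g) h + ham g (D h)) -> exists f, D = ham f.
Proof.
move=> DD DJ; have [h [r Dzr]] := dz_image (D z).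
pose E := D + ham h.
have EE : derivation E by exact: der_add DD (ham_der h).
have EJ g k : E (ham g k) = ham (E g) k + ham g (E k).
  rewrite /E -[LHS]/(D (ham g k) + ham h (ham g k)) DJ jacobi.
  rewrite -[(D + ham h) g]/(D g + ham h g) -[(D + ham h) k]/(D k + ham h k).
  by rewrite (derD (ham_derl k)) (derD (ham_der g)); ring.
have Ez : E z = pz r.
  by rewrite -[LHS]/(D z + ham h z) Dzr ham_z; ring.
have Ex : E x = pz r^`() * x + dz (E x).
  by rewrite -{1}ham_zx EJ Ez ham_x (der_pol ddx) ham_of_z dxz.
have Ey : - E y = - (pz r^`() * y) + dz (E y).
  by rewrite -(derN EE) -ham_zy EJ Ez ham_y (der_pol ddy) ham_of_z dyz.
(* y E(x) would be mapped by dz to - r' p, which lies in C[z], whereas the image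
   of dz has no component there. *)
have r0 : r^`() = 0.
  have : dz (y * E x) = 0 *: (y * E x) + pz (- (r^`() * p)).
    rewrite (derM ddz) dzy scale0r add0r rmorphN rmorphM /= -regxy.
    transitivity (y * (dz (E x) - E x)); first by ring.
    by rewrite {2}Ex; ring.
  case/dz_eigen => U [V [_ /(_ 0%N) + _]].
  rewrite eqxx subrr scale0r => /esym/eqP.
  by rewrite oppr_eq0 mulf_eq0 (negbTE p_neq0) orbF => /eqP.
rewrite r0 rmorph0 mul0r add0r in Ex.
rewrite r0 rmorph0 mul0r oppr0 add0r in Ey.
have [U1 Ex1] : exists U1, E x = x * pz U1.
  have : dz (E x) = 1 *: E x + pz 0 by rewrite -Ex scale1r rmorph0 addr0.
  case/dz_eigen => U [V [-> HU HV]]; exists U`_1.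
  have -> : V = 0.
    apply/polyP => i; have /eqP := HV i; rewrite coef0 scaler_eq0 natr1.
    by rewrite pnatr_eq0 => /eqP.
  have -> : U = 'X * (U`_1)%:P.
    apply/polyP => -[|[|i]]; rewrite coefXM coefC //=.
      by have := HU 0%N; rewrite eqxx sub0r scaleN1r => /eqP; rewrite oppr_eq0 => /eqP.
    have /eqP := HU i.+2; rewrite scaler_eq0 /= -natr1 addrK pnatr_eq0 /=.
    by move/eqP.
  by rewrite ev0 mulr0 addr0 evM evX evC coefXM coefC.
have [V0 Ey0] : exists V0, E y = y * pz V0.
  have : dz (E y) = -1 *: E y + pz 0 by rewrite -Ey scaleN1r rmorph0 addr0.
  case/dz_eigen => U [V [-> HU HV]]; exists V`_0.
  have -> : U = 0.
    apply/polyP => i; have /eqP := HU i; rewrite coef0 opprK if_same natr1.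
    by rewrite scaler_eq0 pnatr_eq0 => /eqP.
  have -> : V = (V`_0)%:P.
    apply/polyP => -[|i]; rewrite coefC //=.
    have /eqP := HV i.+1; rewrite scaler_eq0 -natr1 addrK pnatr_eq0 /=.
    by move/eqP.
  by rewrite ev0 add0r evC coefC.
have E0 : p * (U1 + V0) = p^`() * r.
  apply/eqP; rewrite -subr_eq0; apply/eqP/pz_eq0.
  rewrite rmorphB !rmorphM rmorphD /= -regxy -Ez -(der_pol EE) -regxy (derM EE).
  by rewrite Ex1 Ey0; ring.
have r00 : r = 0.
  apply/eqP; apply: contraT => rn0; have rC := deriv_eq0 r0.
  have p'0 : p^`() != 0.
    apply/eqP => /deriv_eq0 pC; move: p_nonconst; rewrite pC.
    by rewrite ltnNge size_polyC leq_b1.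
  have pr : p %| p^`() * r by rewrite -E0 dvdp_mulIl.
  have : (size p <= size (p^`() * r)%R)%N.
    by apply: dvdp_leq => //; rewrite mulf_neq0.
  have r00 : r`_0 != 0 by apply: contraNneq rn0 => r00; rewrite rC r00.
  by rewrite rC mulrC mul_polyC size_scale // leqNgt lt_size_deriv ?p_neq0.
have V0E : V0 = - U1.
  apply/eqP; rewrite -addr_eq0 addrC; move/eqP: E0.
  by rewrite r00 mulr0 mulf_eq0 (negbTE p_neq0).
have [R RU] := poly_antiderivative U1.
exists (pz R - h).
suff DE : E = ham (pz R).
  apply/funext => g; rewrite (derB (ham_derl g)) /= -DE.
  by rewrite -[E g]/(D g + ham h g) addrK.
apply: (der_ext EE (ham_der _)).
- by rewrite ham_x (der_pol ddx) dxz RU Ex1 mulrC.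
- by rewrite ham_y (der_pol ddy) dyz RU Ey0 V0E rmorphN /=; ring.
- by rewrite ham_z (der_pol ddz) dzz Ez r00 rmorph0; ring.
Qed.

Lemma LND_hamiltonian D : LND D -> exists f, D = ham f.
Proof.
by move=> DL; apply: poisson_hamiltonian; [exact: DL.1|exact: LND_poisson].
Qed.

(** {z, f} = 0 gives f in C[z], and then {f, x} = f' x. *)
Lemma ham_eq0_const f : ham f = 0 -> exists c, f = c%:A.
Proof.
move=> Jf0; have J0 g : ham f g = 0 by rewrite Jf0.
have : dz f = 0 *: f + pz 0.
  by rewrite scale0r rmorph0 addr0 -[dz f]opprK -ham_z J0 oppr0.
case/dz_eigen => U [V [fE HU HV]].
have V0 : V = 0.
  apply/polyP => i; have /eqP := HV i; rewrite coef0 addr0 scaler_eq0.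
  by rewrite pnatr_eq0 => /eqP.
have U0 : U = (U`_0)%:P.
  apply/polyP => -[|i]; rewrite coefC //=; have /eqP := HU i.+1.
  by rewrite subr0 scaler_eq0 pnatr_eq0 => /eqP.
rewrite V0 ev0 mulr0 addr0 U0 evC in fE.
have : pz (U`_0)^`() * x = 0 by rewrite -dxz -(der_pol ddx) -fE -ham_x J0.
case/regfun_mul_eq0 => [/pz_eq0/deriv_eq0 E|/eqP]; last by rewrite (negbTE regx_neq0).
by exists (U`_0)`_0; rewrite fE E horner_algC coefC.
Qed.

(** * Admissible functions *)

Lemma pzM (q r : {poly C}) : pz (q * r) = pz q * pz r :> A.
Proof. exact: rmorphM. Qed.
Lemma pzD (q r : {poly C}) : pz (q + r) = pz q + pz r :> A.
Proof. exact: rmorphD. Qed.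
Lemma pzZ k (r : {poly C}) : pz (k *: r) = k *: (pz r : A).
Proof. by rewrite -mul_polyC pzM -scale_pz. Qed.

(** The form of the theorem, with the double sums collected into bivariate
    polynomials; [admissible_form] gives back the sums. *)
Definition admissible (f : A) := exists U V q c,
  f = x * ev x z U + y * ev y z V + pz (p * q)^`() + c%:A.

Lemma admissible0 : admissible 0.
Proof.
by exists 0, 0, 0, 0; rewrite mulr0 deriv0 !rmorph0 scale0r; ring.
Qed.

Lemma admissibleD f g : admissible f -> admissible g -> admissible (f + g).
Proof.
move=> [U [V [q [c ->]]]] [U' [V' [q' [c' ->]]]].
exists (U + U'), (V + V'), (q + q'), (c + c').
by rewrite mulrDr derivD scalerDl !evD rmorphD /=; ring.
Qed.

Lemma admissibleZ k f : admissible f -> admissible (k *: f).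
Proof.
move=> [U [V [q [c ->]]]]; exists (k%:P%:P * U), (k%:P%:P * V), (k%:P * q), (k * c).
rewrite -scalerA !(scale_pz k) !evM !evC (mulrCA p) deriv_mulC.
by rewrite [pz (k%:P * _)]rmorphM /=; ring.
Qed.

Lemma admissible_sum (I : Type) (s : seq I) (P : pred I) (F : I -> A) :
  (forall i, P i -> admissible (F i)) -> admissible (\sum_(i <- s | P i) F i).
Proof. by move=> gF; apply: (big_ind admissible admissible0 admissibleD gF). Qed.

Lemma admissible_x i r : admissible (x ^+ i.+1 * pz r).
Proof.
exists ('X^i * r%:P), 0, 0, 0; rewrite mulr0 deriv0 !rmorph0 scale0r evM.
by rewrite evXn evC exprS; ring.
Qed.

Lemma admissible_y i r : admissible (y ^+ i.+1 * pz r).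
Proof.
exists 0, ('X^i * r%:P), 0, 0; rewrite mulr0 deriv0 !rmorph0 scale0r evM.
by rewrite evXn evC exprS; ring.
Qed.

Lemma admissible_pq q : admissible (pz (p * q)^`()).
Proof.
by exists 0, 0, q, 0; rewrite scale0r !ev0; ring.
Qed.

Lemma admissible_C c : admissible c%:A.
Proof.
by exists 0, 0, 0, c; rewrite mulr0 deriv0 !rmorph0; ring.
Qed.

Lemma admissible_ind (Pr : A -> Prop) :
  (forall f g, Pr f -> Pr g -> Pr (f + g)) ->
  (forall i r, Pr (x ^+ i.+1 * pz r)) -> (forall i r, Pr (y ^+ i.+1 * pz r)) ->
  (forall q, Pr (pz (p * q)^`())) -> (forall c, Pr c%:A) ->
  forall f, admissible f -> Pr f.
Proof.
move=> PD Px Py Pq PC f [U [V [q [c ->]]]].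
have P0 : Pr 0 by have := PC 0; rewrite scale0r.
apply: (PD); [apply: (PD); [apply: (PD)|]|] => //.
- rewrite evE mulr_sumr; apply: (big_ind Pr); [exact: P0|exact: PD|move=> i _].
  by rewrite mulrA -exprS; exact: Px.
- rewrite evE mulr_sumr; apply: (big_ind Pr); [exact: P0|exact: PD|move=> i _].
  by rewrite mulrA -exprS; exact: Py.
Qed.

Lemma dx_x i r : dx (x ^+ i * pz r) = x ^+ i.+1 * pz r^`().
Proof.
by rewrite (derM ddx) (derX ddx) (der_pol ddx) dxx dxz mulr0 mul0rn exprS; ring.
Qed.

Lemma dx_y i r :
  dx (y ^+ i.+1 * pz r) = y ^+ i * pz (i.+1%:R *: (p^`() * r) + p * r^`()).
Proof.
rewrite (derM ddx) (derX ddx) (der_pol ddx) dxy dxz pzD pzZ !pzM.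
by rewrite scaler_nat -regxy exprS /=; ring.
Qed.

Lemma dy_y i r : dy (y ^+ i * pz r) = y ^+ i.+1 * pz r^`().
Proof.
by rewrite (derM ddy) (derX ddy) (der_pol ddy) dyy dyz mulr0 mul0rn exprS; ring.
Qed.

Lemma dy_x i r :
  dy (x ^+ i.+1 * pz r) = x ^+ i * pz (i.+1%:R *: (p^`() * r) + p * r^`()).
Proof.
rewrite (derM ddy) (derX ddy) (der_pol ddy) dyx dyz pzD pzZ !pzM.
by rewrite scaler_nat -regxy exprS /=; ring.
Qed.

(** The only term of C[z] comes from y r(z), and is (p r)'. *)
Lemma admissible_dx f : admissible (dx f).
Proof.
elim/regfun_span: f => [|f g Hf Hg|i r|i r].
- by rewrite (der0 ddx); exact: admissible0.
- by rewrite (derD ddx); exact: admissibleD.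
- by rewrite dx_x; exact: admissible_x.
- rewrite dx_y; case: i => [|i]; last exact: admissible_y.
  by rewrite expr0 mul1r scale1r -derivM; exact: admissible_pq.
Qed.

Lemma admissible_dy f : admissible (dy f).
Proof.
elim/regfun_span: f => [|f g Hf Hg|i r|i r].
- by rewrite (der0 ddy); exact: admissible0.
- by rewrite (derD ddy); exact: admissibleD.
- case: i => [|i]; first by rewrite -[x ^+ 0]/(y ^+ 0) dy_y; exact: admissible_y.
  rewrite dy_x; case: i => [|i]; last exact: admissible_x.
  by rewrite expr0 mul1r scale1r -derivM; exact: admissible_pq.
- by rewrite dy_y; exact: admissible_y.
Qed.

Lemma admissible_dz f : admissible (dz f).
Proof.
elim/regfun_span: f => [|f g Hf Hg|i r|i r].
- by rewrite (der0 ddz); exact: admissible0.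
- by rewrite (derD ddz); exact: admissibleD.
- case: i => [|i]; first by rewrite dz_x mulr0n; exact: admissible0.
  by rewrite dz_x -scaler_nat; apply: admissibleZ; exact: admissible_x.
- by rewrite dz_y mulNrn -scaleN1r -scaler_nat; do 2! apply: admissibleZ; exact: admissible_y.
Qed.

(** {f, gh} = {fh, g} + {fg, h} reduces the second argument to x, y, z. *)
Lemma admissible_ham f g : admissible (ham f g).
Proof.
elim/regfun_ind: g f => [c|g h Hg Hh|g h Hg Hh|||] f.
- by rewrite (derC (ham_der f)); exact: admissible0.
- by rewrite (derD (ham_der f)); apply: admissibleD.
- have -> : ham f (g * h) = ham (f * h) g + ham (f * g) h.
    rewrite (derM (ham_der f)) (derM (ham_derl g)) (derM (ham_derl h)).
    by rewrite [ham h g]ham_anti; ring.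
  exact: admissibleD.
- by rewrite ham_x; exact: admissible_dx.
- by rewrite ham_y -scaleN1r; apply: admissibleZ; exact: admissible_dy.
- by rewrite ham_z -scaleN1r; apply: admissibleZ; exact: admissible_dz.
Qed.

(** * Automorphisms of the surface *)

Section Endomorphisms.
Variable phi : {lrmorphism A -> A}.
Lemma endoD f g : phi (f + g) = phi f + phi g. Proof. exact: rmorphD. Qed.
Lemma endoM f g : phi (f * g) = phi f * phi g. Proof. exact: rmorphM. Qed.
Lemma endoX f i : phi (f ^+ i) = phi f ^+ i. Proof. exact: rmorphXn. Qed.
Lemma endoZ c f : phi (c *: f) = c *: phi f. Proof. exact: linearZ. Qed.
Lemma endo_1 : phi 1 = 1. Proof. exact: rmorph1. Qed.
End Endomorphisms.

Section Automorphism.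
Variables (phi psi : {lrmorphism A -> A}) (s : C).
Hypotheses (phiK : cancel phi psi) (psiK : cancel psi phi).
Hypothesis phi_ham : ham (phi y) (phi z) = s *: phi y.

(** The pulled back bracket is an alternating biderivation, hence it suffices to
    compare at (y, z). *)
Lemma automorphism_ham f g : ham (phi f) (phi g) = s *: phi (ham f g).
Proof.
pose K a b := psi (ham (phi a) (phi b)).
have DK a : derivation (K a).
  split=> [c b d|b d]; rewrite /K.
    by rewrite linearP /= (der_lin (ham_der _)) linearP.
  by rewrite rmorphM (derM (ham_der _)) rmorphD !rmorphM /= !phiK.
have Kanti a b : K a b = - K b a by rewrite /K ham_anti rmorphN.
have := biderivation_ham DK Kanti f g.
rewrite {2}/K phi_ham linearZ /= phiK -scalerAr scalerAl mulrC [_ * y]mulrC.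
move/(regfun_mulfI regy_neq0) => E.
by rewrite -[LHS]psiK -[psi _]/(K f g) E linearZ.
Qed.

Lemma automorphism_LND f : LND (ham f) -> LND (ham (phi f)).
Proof.
move=> [_ nil]; split=> [|g]; first exact: ham_der.
have JE h : ham (phi f) h = s *: phi (ham f (psi h)).
  by rewrite -automorphism_ham psiK.
have itE N h : iter N (ham (phi f)) h = s ^+ N *: phi (iter N (ham f) (psi h)).
  elim: N => [|N IH]; first by rewrite scale1r psiK.
  by rewrite iterS IH (derZ (ham_der _)) JE phiK scalerA -exprSr.
by have [N nN] := nil (psi g); exists N; rewrite itE nN rmorph0 scaler0.
Qed.

Lemma automorphism_ev a b F : phi (ev a b F) = ev (phi a) (phi b) F.
Proof.
rewrite !evE rmorph_sum; apply: eq_bigr => i _.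
rewrite rmorphM rmorphXn /=; congr (_ * _).
elim/poly_ind: (F`_i) => [|r c IH]; first by rewrite !rmorph0.
by rewrite !rmorphD !rmorphM /= !horner_algX !horner_algC IH linearZ /= rmorph1.
Qed.
End Automorphism.

Fact swap_subproof : y * x = pz p.
Proof. by rewrite mulrC regxy. Qed.

Definition swap : {lrmorphism A -> A} := endo swap_subproof.

Lemma swap_x : swap x = y. Proof. exact: endo_x. Qed.
Lemma swap_y : swap y = x. Proof. exact: endo_y. Qed.
Lemma swap_z : swap z = z. Proof. exact: endo_z. Qed.

Lemma lrmorph_ext (phi psi : {lrmorphism A -> A}) :
  phi x = psi x -> phi y = psi y -> phi z = psi z -> phi =1 psi.
Proof.
move=> ex ey ez; elim/regfun_ind => [c|f g Hf Hg|f g Hf Hg|||] //.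
- by rewrite !endoZ !endo_1.
- by rewrite !endoD Hf Hg.
- by rewrite !endoM Hf Hg.
Qed.

Lemma swapK : involutive swap.
Proof.
move=> f; have E : (swap \o swap : {lrmorphism A -> A}) =1 idfun.
  by apply: lrmorph_ext; rewrite /= ?swap_x ?swap_y ?swap_z ?swap_x ?swap_y.
exact: E.
Qed.

Lemma swap_pz r : swap (pz r) = pz r.
Proof. by rewrite -(evC x z) automorphism_ev swap_x swap_z !evC. Qed.

Lemma swap_LND f : LND (ham f) -> LND (ham (swap f)).
Proof.
apply: (@automorphism_LND swap swap (-1)); [exact: swapK|exact: swapK|].
by rewrite swap_y swap_z scaleN1r ham_of_x dxz.
Qed.

Lemma swap_admissible f : admissible (swap f) -> admissible f.
Proof.
rewrite -{2}[f]swapK; move: (swap f); apply: admissible_ind => [a b Ha Hb|i r|i r|q|c].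
- by rewrite endoD; exact: admissibleD.
- by rewrite endoM endoX swap_x swap_pz; exact: admissible_y.
- by rewrite endoM endoX swap_y swap_pz; exact: admissible_x.
- by rewrite swap_pz; exact: admissible_pq.
- by rewrite endoZ endo_1; exact: admissible_C.
Qed.

Section Shear.
Variable j : nat.
Implicit Type l : C.

Lemma horner_alg_increment (a w : A) r :
  exists t, horner_alg (a + w) r = horner_alg a r + w * t.
Proof.
elim/poly_ind: r => [|r c [t IH]]; first by exists 0; rewrite !rmorph0; ring.
exists (horner_alg a r + t * (a + w)).
by rewrite !rmorphD !rmorphM /= !horner_algX !horner_algC IH; ring.
Qed.

(** (p(z + l y^(j+1)) - p(z)) / (l y^(j+1)), by which x has to change for the
    equation of the surface to be kept. *)
Definition shear_quotient l :=
  projT1 (cid (horner_alg_increment z (l *: y ^+ j.+1) p)).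

Fact shear_subproof l : (x + l *: y ^+ j * shear_quotient l) * y
  = horner_alg (z + l *: y ^+ j.+1) p.
Proof.
rewrite /shear_quotient; case: cid => t /= ->; rewrite -regxy !scale_pz exprS.
by ring.
Qed.

(** The time l flow of an LND of the form c {y^(j+1), .}. *)
Definition shear l : {lrmorphism A -> A} := endo (shear_subproof l).

Lemma shear_y l : shear l y = y. Proof. exact: endo_y. Qed.
Lemma shear_z l : shear l z = z + l *: y ^+ j.+1. Proof. exact: endo_z. Qed.
Lemma shear_pz l r : shear l (pz r) = horner_alg (z + l *: y ^+ j.+1) r.
Proof. by rewrite -(evC x z) automorphism_ev shear_z evC. Qed.

(** The values at x need not be computed: x is determined by y x = p(z). *)
Lemma shearK l : cancel (shear l) (shear (- l)).
Proof.
move=> f; have E : (shear (- l) \o shear l : {lrmorphism A -> A}) =1 idfun.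
  have Ez : shear (- l) (shear l z) = z.
    rewrite shear_z endoD endoZ endoX shear_y shear_z scaleNr.
    by rewrite addrNK.
  have Ey : shear (- l) (shear l y) = y by rewrite !shear_y.
  apply: lrmorph_ext => //=.
  apply: (regfun_mulfI regy_neq0); rewrite -{1}Ey -!endoM [y * x]mulrC regxy.
  by rewrite -(evC x z) !automorphism_ev Ez !evC -regxy.
exact: E.
Qed.

Lemma shear_LND l f : LND (ham f) -> LND (ham (shear l f)).
Proof.
apply: (@automorphism_LND _ (shear (- l)) 1); first exact: shearK.
  by move=> g; rewrite -{1}[l]opprK shearK.
rewrite shear_y shear_z scale1r ham_of_y (derD ddy) dyz (derZ ddy) (derX ddy) dyy.
by rewrite mulr0 mul0rn scaler0 addr0.
Qed.

(** These are the Taylor terms of the sheared x^(i+1) r(z): multiplied by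
    y^(i+1) it is F(z + l y^(j+1)) with F = p^(i+1) r.  Division of the m-th term
    by y^(i+1) leaves a positive power of y, or a power of x because many factors
    p remain in the m-th derivative, or, when (j+1) m = i+1, a
    derivative of a multiple of p. *)
Lemma admissible_taylor_term i r m : exists t,
  admissible t /\ y ^+ i.+1 * t = y ^+ (j.+1 * m) * pz (p ^+ i.+1 * r)^`N(m).
Proof.
set F := p ^+ i.+1 * r.
have [->|m0] := eqVneq m 0%N.
  exists (x ^+ i.+1 * pz r); split; first exact: admissible_x.
  rewrite muln0 nderivn0 expr0 mul1r /F pzM rmorphXn /= -regxy exprMn; ring.
have dF : p ^+ i.+1 %| F by rewrite dvdp_mulIl.
have FN k : F^`N(k) = k`!%:R^-1 *: F^`(k).
  by rewrite nderivn_def -scaler_nat scalerA mulVf ?scale1r // pnatr_eq0 -lt0n fact_gt0.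
have [lt_i|le_i] := ltnP i.+1 (j.+1 * m).
  exists (y ^+ (j.+1 * m - i.+1) * pz F^`N(m)); split.
    by rewrite -(prednK (n := j.+1 * m - i.+1)) ?subn_gt0 //; exact: admissible_y.
  by rewrite mulrA -exprD subnKC // ltnW.
case: m m0 le_i => // m _ le_i.
have [E|lt_i] := eqVneq (j.+1 * m.+1)%N i.+1.
  exists (pz F^`N(m.+1)); split; last by rewrite E.
  have : p ^+ 1 %| F^`(m).
    apply: dvdp_trans (dvdp_derivn m dF); apply: dvdp_exp2l; lia.
  rewrite expr1 => /dvdpP[q Fq].
  by rewrite FN pzZ derivnS Fq mulrC; apply: admissibleZ; exact: admissible_pq.
pose k := (i.+1 - j.+1 * m.+1)%N; have k0 : (0 < k)%N by rewrite subn_gt0; lia.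
have : p ^+ k %| F^`(m.+1).
  by apply: dvdp_trans (dvdp_derivn m.+1 dF); apply: dvdp_exp2l; rewrite /k; lia.
case/dvdpP => q Fq; exists (m.+1`!%:R^-1 *: (x ^+ k * pz q)); split.
  by apply: admissibleZ; rewrite -(prednK k0); exact: admissible_x.
rewrite FN pzZ Fq pzM rmorphXn /= -regxy exprMn -!scalerAr; congr (_ *: _).
have -> : i.+1 = (j.+1 * m.+1 + k)%N by rewrite /k subnKC.
by rewrite exprD; ring.
Qed.

Lemma shear_admissible l f : admissible f -> admissible (shear l f).
Proof.
move: f; apply: admissible_ind => [a b Ha Hb|i r|i r|q|c].
- by rewrite endoD; exact: admissibleD.
- pose t m := projT1 (cid (admissible_taylor_term i r m)).
  have tP m : admissible (t m) /\
      y ^+ i.+1 * t m = y ^+ (j.+1 * m) * pz (p ^+ i.+1 * r)^`N(m).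
    by rewrite /t; case: cid.
  set F := p ^+ i.+1 * r in t tP *.
  have -> : shear l (x ^+ i.+1 * pz r) = \sum_(m < size F) l ^+ m *: t m.
    apply: (regfun_mulfI (regfun_exp_neq0 i.+1 regy_neq0)).
    transitivity (shear l (pz F)).
      rewrite -{1}(shear_y l) -endoX -endoM mulrA -exprMn mulrC.
      by rewrite [y * x]mulrC regxy -rmorphXn -pzM mulrC.
    rewrite shear_pz horner_alg_taylor mulr_sumr; apply: eq_bigr => m _.
    by rewrite exprZn -exprM -!scalerAr (tP m).2 mulrC.
  by apply: admissible_sum => m _; apply: admissibleZ; case: (tP m).
- rewrite endoM endoX shear_y shear_pz horner_alg_taylor mulr_sumr.
  apply: admissible_sum => m _; rewrite exprZn -exprM -!scalerAr; apply: admissibleZ.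
  by rewrite mulrCA mulrC -exprD addSn; exact: admissible_y.
- rewrite shear_pz horner_alg_taylor; case: (size _) => [|n].
    by rewrite big_ord0; exact: admissible0.
  rewrite big_ord_recl /=; apply: admissibleD.
    by rewrite nderivn0 expr0 mulr1; exact: admissible_pq.
  apply: admissible_sum => m _; rewrite exprZn -exprM -!scalerAr; apply: admissibleZ.
  by rewrite mulrC -(prednK (n := j.+1 * _)) ?muln_gt0 //; exact: admissible_y.
- by rewrite endoZ endo_1; exact: admissible_C.
Qed.
End Shear.

(** * Symbols *)

(** The expansion of [f] in the chart y <> 0, as F / y^N. *)
Definition laurent (f : A) (N : nat) (F : {poly {poly C}}) := y ^+ N * f = ev y z F.

Lemma laurent_y : laurent y 0 'X.
Proof. by rewrite /laurent evX expr0 mul1r. Qed.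

Lemma laurent_x : laurent x 1 p%:P.
Proof. by rewrite /laurent evC expr1 mulrC regxy. Qed.

Lemma laurent_widen f N F k : laurent f N F -> laurent f (k + N) ('X^k * F).
Proof. by rewrite /laurent evM evXn exprD -mulrA => ->. Qed.

(** In this chart {f, g} = y (f_y g_z - f_z g_y); the quotient rule for F / y^N
    produces y F_y - N F. *)
Lemma laurent_ham f g N M F G : laurent f N F -> laurent g M G ->
  laurent (ham f g) (N + M) (deriv_inner F * (G *+ M - 'X * G^`())
                       - (F *+ N - 'X * F^`()) * deriv_inner G).
Proof.
have Hdy h L H : laurent h L H -> y ^+ L * dy h = y * ev y z (deriv_inner H).
  move=> Hh; have /(congr1 dy) := Hh; rewrite (der_ev _ _ _ ddy) dyy dyz.
  by rewrite (derM ddy) (derX ddy) dyy !mulr0 mul0rn mul0r !add0r => ->; exact: mulrC.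
have Hdz h L H : laurent h L H ->
    y ^+ L * dz h = ev y z (H *+ L - 'X * H^`()).
  move=> Hh; have /(congr1 dz) := Hh; rewrite (der_ev _ _ _ ddz) dzy dzz.
  rewrite (derM ddz) (derX ddz) dzy mulr0 addr0.
  have -> : (y ^+ L.-1 * - y) *+ L * h = - (y ^+ L * h) *+ L.
    by case: L {Hh} => [|L] /=; rewrite ?mulr0n ?mul0r // exprS; ring.
  rewrite Hh evB evM evX [ev y z (_ *+ _)]rmorphMn /= => E.
  transitivity (- ev y z H *+ L + y ^+ L * dz h + ev y z H *+ L); first by ring.
  by rewrite E; ring.
move=> Hf Hg; have := y_der g (ham_der f); rewrite ham_z ham_y => E.
apply: (regfun_mulfI regy_neq0); rewrite mulrCA E evB !evM.
rewrite -(Hdz _ _ _ Hf) -(Hdz _ _ _ Hg).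
transitivity ((y ^+ N * dy f) * (y ^+ M * dz g) - (y ^+ N * dz f) * (y ^+ M * dy g)).
  by rewrite exprD; ring.
by rewrite (Hdy _ _ _ Hf) (Hdy _ _ _ Hg); ring.
Qed.

Section Symbols.
Variables b c : nat.
Hypotheses (b0 : (0 < b)%N).
Local Notation wt := (wt b c).

(** [G] is the weight of the monomials that make up [Q]; it may be negative
    because y occurs in the denominator.  [Q] is allowed to vanish, so that
    brackets have symbols even when the top parts cancel. *)
Definition symbol (g : A) (G : int) (Q : {poly C}) := exists N F m,
  [/\ laurent g N F, (size (wt F) <= m.+1)%N, (wt F)`_m = Q
    & G = m%:Z - (b * N)%:Z].

Lemma symbol_neq0 g G Q : symbol g G Q -> Q != 0 -> g != 0.
Proof.
move=> [N [F [m [gF _ <- _]]]]; apply: contraNneq => g0.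
by move: gF; rewrite /laurent g0 mulr0 => /esym/ev_eq0 ->; rewrite wt0 coef0.
Qed.

Lemma symbol_uniq g G Q G' Q' : symbol g G Q -> symbol g G' Q' -> Q != 0 -> Q' != 0 ->
  G = G' /\ Q = Q'.
Proof.
move=> [N [F [m [gF sF FQ ->]]]] [N' [F' [m' [gF' sF' FQ' ->]]]] Q0 Q0'.
have E : 'X^N' * F = 'X^N * F'.
  apply/eqP; rewrite -subr_eq0; apply/eqP/ev_eq0.
  by rewrite evB !evM !evXn -gF -gF'; ring.
have leadE (K : {poly {poly C}}) k R : (size (wt K) <= k.+1)%N -> (wt K)`_k = R -> R != 0 ->
    size (wt K) = k.+1 /\ lead_coef (wt K) = R.
  move=> sK KR R0; have sE : size (wt K) = k.+1.
    apply/eqP; rewrite eqn_leq sK ltnNge; apply: contra_neqN R0 => sK'.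
    by rewrite -KR nth_default.
  by rewrite lead_coefE sE.
have [sE lE] := leadE F _ _ sF FQ Q0; have [sE' lE'] := leadE F' _ _ sF' FQ' Q0'.
have {}E : wt F * 'X^(b * N') = wt F' * 'X^(b * N).
  by rewrite -!(wtXn C b c) -!wtM mulrC E mulrC.
have wn0 : wt F != 0 by rewrite -size_poly_eq0 sE.
have wn0' : wt F' != 0 by rewrite -size_poly_eq0 sE'.
split; last first.
  by rewrite -lE -lE' -(lead_coef_Mmonic _ (monicXn _ (b * N'))) E
    lead_coef_Mmonic ?monicXn.
have := congr1 (fun H : {poly {poly C}} => size H) E.
rewrite (size_mulXn _ wn0) (size_mulXn _ wn0') sE sE'; lia.
Qed.

Lemma symbol_widen g N F m k : laurent g N F -> (size (wt F) <= m.+1)%N ->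
  [/\ laurent g (k + N) ('X^k * F), (size (wt ('X^k * F)) <= (b * k + m).+1)%N
    & (wt ('X^k * F))`_(b * k + m) = (wt F)`_m].
Proof.
move=> gF sF; split; first exact: laurent_widen.
  rewrite wtM wtXn (leq_trans (size_polyMleq _ _)) // size_polyXn; lia.
by rewrite wtM wtXn mulrC coefMXn ltnNge leq_addr /= addKn.
Qed.

(** The derivative in y of a quasihomogeneous part of weight W is found from
    Euler's relation b y P_y + c z P_z = W P, which replaces the bracket by an
    expression in P and Q as functions of xi; the terms with c
    cancel. *)
Lemma symbol_ham f g W G P Q : symbol f W P -> symbol g G Q -> exists K,
  symbol (ham f g) (W + G - c%:Z) K /\
  K *+ b = (P * Q^`()) *~ W - (P^`() * Q) *~ G.
Proof.
move=> [N0 [F0 [m0 [fF0 sF0 <- ->]]]] [M [G0 [m' [gG sG <- ->]]]].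
(* The exponent in T drops by c; enlarging the denominator first keeps it
   nonnegative. *)
have [fF sF FE] := symbol_widen c fF0 sF0.
move: ('X^c * F0) fF sF FE => F fF sF FE; set N := (c + N0)%N in fF.
set m := (b * c + m0)%N in sF FE.
have cm : (c <= m)%N by rewrite /m; nia.
pose K := deriv_inner F * (G0 *+ M - 'X * G0^`()) - (F *+ N - 'X * F^`()) * deriv_inner G0.
have KE : 'X^c * (wt K *+ b) = deriv_inner (wt F) * (wt G0 *+ (b * M) - 'X * (wt G0)^`())
    - (wt F *+ (b * N) - 'X * (wt F)^`()) * deriv_inner (wt G0).
  rewrite -!wt_deriv_inner // /K wtB !wtM !wtB !wtMn.
  have EG := wt_euler b c G0; have EF := wt_euler b c F.
  rewrite -!(wt_deriv_inner b c) in EG EF.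
  exact: symbol_ring_identity EG EF.
have [sK KQ] := coef_top_bracket b0 cm sF sG KE.
exists (wt K)`_(m + m' - c); split.
  exists (N + M)%N, K, (m + m' - c)%N; split => //; first exact: laurent_ham.
  by rewrite /N /m; lia.
rewrite KQ FE; congr (_ *~ _ - _); rewrite /m /N; lia.
Qed.
End Symbols.

(** * What local nilpotency says about a symbol *)

Section Growth.
Variables b c : nat.
Hypotheses (b0 : (0 < b)%N) (c0 : (0 < c)%N).
Local Notation wt := (wt b c).

Lemma symbol_laurent g N F m : laurent g N F -> (size (wt F) <= m.+1)%N ->
  symbol b c g (m%:Z - (b * N)%:Z) (wt F)`_m.
Proof. by move=> gF sF; exists N, F, m. Qed.

Lemma symbol_y : symbol b c y b%:Z 1.
Proof.
have := @symbol_laurent y 0 'X b laurent_y; rewrite -['X]/('X^1) wtXn muln1 size_polyXn leqnn.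
by rewrite coefXn eqxx muln0 subr0; apply.
Qed.

Lemma symbol_x : symbol b c x ((c * n)%:Z - b%:Z) (lead_coef p *: 'X^n).
Proof.
have pc l k : (p%:P : {poly {poly C}})`_l`_k != 0 -> l = 0%N /\ (k <= n)%N.
  rewrite coefC; have [l0 pk|_] := eqVneq l 0%N; last by rewrite coef0 eqxx.
  split=> //; rewrite -ltnS prednK ?(ltnW p_nonconst) // ltnNge.
  by apply: contra_neqN pk => le; rewrite nth_default.
have := @symbol_laurent x 1 p%:P (c * n)%N laurent_x; rewrite muln1.
have -> : (wt p%:P)`_(c * n) = lead_coef p *: 'X^n.
  apply/polyP => k; rewrite coefZ coefXn; have [->|kn] := eqVneq k n.
    by rewrite mulr1 -[(c * n)%N]add0n -(muln0 b) coef_wt // coefC lead_coefE.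
  rewrite mulr0; apply/eqP; apply: contraNT kn => /(coef_wt_neq0 b0)[l [+ /pc[l0 _]]].
  by move=> /eqP; rewrite l0 muln0 add0n eqn_pmul2l // eq_sym.
apply; apply: size_wt => // l k /pc[l0 kn].
by rewrite l0 muln0 add0n leq_mul2l kn orbT.
Qed.

Variables (f : A) (W : int) (P : {poly C}).
Hypotheses (LNDf : LND (ham f)) (symf : symbol b c f W P).

(** Suppose the equation fails for every m.  Then [degree_step] applies at every
    iteration of {f, .} on g, the symbols have degree q + m d and weight
    G + m (W - c), and no iterate is 0. *)
Lemma growth_degree g G Q d q : size P = d.+2 -> symbol b c g G Q ->
  size Q = q.+1 -> exists2 m : nat, true &
  W * (q + m * d)%:Z = (G + m%:Z * (W - c%:Z)) * d.+1%:Z.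
Proof.
move=> sP gQ sQ; apply: contrapT => no_m.
have [N gN] := LNDf.2 g.
suff [Q' [gQ' sQ']] : exists Q', symbol b c (iter N (ham f) g)
    (G + N%:Z * (W - c%:Z)) Q' /\ size Q' = (q + N * d).+1.
  by have := symbol_neq0 gQ'; rewrite gN eqxx -size_poly_gt0 sQ' => /(_ isT).
elim: N {gN} => [|N [Q' [gQ' sQ']]].
  by exists Q; rewrite mul0r addr0 mul0n addn0.
have [K [gK KE]] := symbol_ham b0 symf gQ'; exists K; split.
  rewrite iterS; move: gK; congr (symbol b c _ _ _); lia.
rewrite (degree_step b0 sP sQ' KE) ?mulSn; first by rewrite addnA addnAC addnC; lia.
rewrite subr_eq0; apply/eqP => E; apply: no_m; exists N => //.
Qed.

(** As [growth_degree], following the multiplicity of a root of P by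
    [root_step]. *)
Lemma growth_root g G Q d q a : 
  (exists2 P1, P = ('X - a%:P) ^+ d.+1 * P1 & P1.[a] != 0) -> symbol b c g G Q ->
  (exists2 Q1, Q = ('X - a%:P) ^+ q * Q1 & Q1.[a] != 0) -> exists2 m : nat, true &
  W * (q + m * d)%:Z = (G + m%:Z * (W - c%:Z)) * d.+1%:Z.
Proof.
move=> PE gQ QE; apply: contrapT => no_m.
have [N gN] := LNDf.2 g.
suff [Q' [gQ' [Q1 QE' Q1a]]] : exists Q', symbol b c (iter N (ham f) g)
    (G + N%:Z * (W - c%:Z)) Q' /\
    exists2 Q1, Q' = ('X - a%:P) ^+ (q + N * d) * Q1 & Q1.[a] != 0.
  suff Q'0 : Q' != 0 by have := symbol_neq0 gQ' Q'0; rewrite gN eqxx.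
  rewrite QE' mulf_neq0 ?expf_neq0 ?polyXsubC_eq0 //.
  by apply: contraNneq Q1a => ->; rewrite horner0.
elim: N {gN} => [|N [Q' [gQ' QE']]].
  by exists Q; rewrite mul0r addr0 mul0n addn0.
have [K [gK KE]] := symbol_ham b0 symf gQ'; exists K; split.
  rewrite iterS; move: gK; congr (symbol b c _ _ _); lia.
have [|K1 K1E K1a] := root_step b0 PE QE' KE.
  by rewrite subr_eq0; apply/eqP => E; apply: no_m; exists N.
by exists K1 => //; rewrite K1E; congr (_ ^+ _ * _); rewrite mulSn; lia.
Qed.

(** For g = y the equation of [growth_root] is m (c (d+1) - W) = b (d+1). *)
Lemma root_multiplicity a d :
  (exists2 P1, P = ('X - a%:P) ^+ d.+1 * P1 & P1.[a] != 0) ->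
  W < (c * d.+1)%:Z.
Proof.
move=> PE; have [|m _ E] := growth_root PE symbol_y (q := 0%N).
  by exists 1; rewrite ?expr0 ?mul1r ?hornerC ?oner_neq0.
by rewrite ltNge; apply/negP => cW; nia.
Qed.

Lemma degree_from_y d : size P = d.+2 -> W < (c * d.+1)%:Z.
Proof.
move=> sP; have [|m _ E] := growth_degree sP symbol_y (q := 0%N).
  by rewrite size_poly1.
by rewrite ltNge; apply/negP => cW; nia.
Qed.

(** For g = x, with the symbol xi^n of weight c n - b, the equation of
    [growth_degree] is m (c (d+1) - W) = (c n - b) (d+1) - W n. *)
Lemma degree_from_x d : size P = d.+2 -> (c * d.+1)%:Z >= W ->
  W * n%:Z <= (c * n - b)%:Z * d.+1%:Z.
Proof.
move=> sP cW; have [|m _ E] := growth_degree sP symbol_x (q := n).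
  by rewrite size_scale ?size_polyXn // lead_coef_eq0 p_neq0.
rewrite leNgt; apply/negP => H; nia.
Qed.
End Growth.

(** * The Newton polygon of a locally nilpotent Hamiltonian *)

(** y^N times the normal form of [regfun_nf], after x^e = p(z)^e / y^e. *)
Definition laurent_nf (U V : {poly {poly C}}) (N : nat) : {poly {poly C}} :=
  \poly_(l < N.+1) (p ^+ (N - l) * U`_(N - l)) + V * 'X^(N.+1).

Lemma coef_laurent_nf (U V : {poly {poly C}}) N l : (laurent_nf U V N)`_l =
  if (l <= N)%N then p ^+ (N - l) * U`_(N - l) else V`_(l - N.+1).
Proof.
by rewrite coefD coef_poly coefMXn ltnS; case: ltnP; rewrite ?addr0 ?add0r.
Qed.

Lemma laurent_nfP (U V : {poly {poly C}}) N : (size U <= N.+1)%N ->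
  laurent (ev x z U + y * ev y z V) N (laurent_nf U V N).
Proof.
move=> sU; rewrite /laurent evD evM evXn mulrDr; congr (_ + _); last first.
  by rewrite exprSr; ring.
rewrite poly_def [RHS]rmorph_sum /= evE mulr_sumr.
rewrite (big_ord_widen _ (fun i => y ^+ N * (x ^+ i * pz U`_i)) sU) big_mkcond.
rewrite (reindex_inj rev_ord_inj) /=; apply: eq_bigr => l _.
rewrite -mul_polyC evM evC evXn pzM [pz (_ ^+ _)]rmorphXn /= -regxy subSS.
have lN : (l <= N)%N by rewrite -ltnS.
case: ltnP => [_|le]; last by rewrite nth_default // rmorph0 mulr0 mul0r.
by rewrite -{1}(subnK lN) exprD exprMn; ring.
Qed.

Section Vertex.
Variables (f : A) (U V : {poly {poly C}}) (i0 k0 : nat).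
Hypotheses (fE : f = ev x z U + y * ev y z V) (f0 : f != 0) (LNDf : LND (ham f)).
Hypothesis pureU : forall e, size U`_e = 1%N -> (e <= i0)%N.
Hypothesis pureV : forall e, size V`_e = 1%N -> (e < k0)%N.

Variables b c : nat.
Hypotheses (b0 : (0 < b)%N) (c0 : (0 < c)%N) (bcn : (b < c * n)%N).
Local Notation wt := (wt b c).
Local Notation N := (size U).
Local Notation F := (laurent_nf U V N).
Local Notation m := (size (wt F)).-1.
Local Notation P := ((wt F)`_m).

Lemma top_symbol : symbol b c f (m%:Z - (b * N)%:Z) P /\ P != 0.
Proof.
have lF : laurent f N F by rewrite fE; apply: laurent_nfP.
have wF0 : wt F != 0.
  apply: contraNneq f0 => /(wt_eq0 b0) F0; move: lF; rewrite F0 /laurent ev0.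
  move=> /regfun_mul_eq0[/eqP|/eqP//].
  by rewrite (negbTE (regfun_exp_neq0 _ regy_neq0)).
split; last by rewrite -lead_coefE lead_coef_eq0.
by apply: symbol_laurent => //; case: size.
Qed.

(** Look at the monomial of F that gives the leading term of P, of degree d.  If
    it comes from y^k z^d with k >= 0, then W = b k + c d >= c d, which
    [degree_from_y] excludes unless d = 0.  If it comes from x^e r(z), then
    d = n e + deg r and W = (c n - b) e + c deg r, and [degree_from_x] gives
    deg r = 0.  In both cases it belongs to a pure power of y or x, so the
    hypotheses [pureU] and [pureV] bound its weight. *)
Lemma vertex_bound : (m <= b * N + maxn ((c * n - b) * i0) (b * k0))%N /\
  (size P <= (n * i0).+1)%N.
Proof.
have [symf P0] := top_symbol.
have sP : size P = (size P).-1.+1 by rewrite prednK // size_poly_gt0.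
have Pd : P`_(size P).-1 != 0 by rewrite -lead_coefE lead_coef_eq0.
have [l [ml Fld]] := coef_wt_neq0 b0 Pd.
have leF k : F`_l`_k != 0 -> (k <= (size P).-1)%N.
  by move=> /(coef_le_size_wt c b0) H; rewrite -(leq_pmul2l c0) -(leq_add2l (b * l)) -ml.
have sF : size F`_l = size P.
  apply/eqP; rewrite eqn_leq; apply/andP; split; last first.
    rewrite sP ltnNge; apply: contra_neqN Fld => le; exact: nth_default.
  have Fl0 : F`_l != 0 by apply: contraNneq Fld => ->; rewrite coef0.
  rewrite [X in (_ <= X)%N]sP -[X in (X <= _)%N]prednK ?size_poly_gt0 // ltnS.
  by apply: leF; rewrite -lead_coefE lead_coef_eq0.
(* N <= l means the exponent l - N >= 0 of y, and l < N the exponent N - l of x. *)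
have [lN|Nl] := ltnP l N; last first.
  have d0 : (size P).-1 = 0%N.
    case d: (size P).-1 => [//|d']; rewrite d in ml sP.
    have := degree_from_y b0 c0 LNDf symf sP; rewrite ml; nia.
  rewrite d0 muln0 addn0 in ml; split; last by rewrite sP d0.
  rewrite ml -leq_subLR -mulnBr; have [->|lN] := eqVneq l N; first by rewrite subnn muln0.
  have {}Nl : (N < l)%N by rewrite ltn_neqAle eq_sym lN.
  have VE : size V`_(l - N.+1) = 1%N.
    by move: sF; rewrite coef_laurent_nf leqNgt Nl /= sP d0.
  rewrite leq_max leq_pmul2l //; apply/orP; right.
  by have := pureV VE; lia.
pose e := (N - l)%N; have e0 : (0 < e)%N by rewrite subn_gt0.
have FE : F`_l = p ^+ e * U`_e by rewrite coef_laurent_nf (ltnW lN).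
have Ue0 : U`_e != 0.
  by apply: contraNneq P0 => Ue; rewrite -size_poly_eq0 -sF FE Ue mulr0 size_poly0.
have dE : (size P).-1 = (n * e + (size (U`_e)%R).-1)%N.
  have se : size (p ^+ e) = (n * e).+1.
    by rewrite -size_exp prednK // size_poly_gt0 expf_neq0 // p_neq0.
  rewrite -sF FE size_mul ?expf_neq0 ?p_neq0 // se addSn /=.
  by rewrite -(prednK (n := size U`_e)) ?size_poly_gt0 // addnS.
have Ue1 : size U`_e = 1%N.
  have : (0 < size (U`_e)%R)%N by rewrite size_poly_gt0.
  case sU : (size U`_e) => [//|[//|j]] _; rewrite sU /= in dE.
  have d1 : (size P).-1 = (n * e + j).+1 by rewrite dE addnS.
  rewrite d1 in ml sP; have := degree_from_x b0 c0 LNDf symf sP.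
  rewrite ml => H; exfalso; move: H; rewrite /e; nia.
have ei0 := pureU Ue1.
rewrite Ue1 addn0 in dE; split; last first.
  by rewrite sP dE ltnS leq_mul2l ei0 orbT.
rewrite ml dE; have -> : (b * l + c * (n * e) = b * N + (c * n - b) * e)%N.
  rewrite /e; nia.
by rewrite leq_add2l leq_max leq_mul2l ei0 orbT.
Qed.
End Vertex.

Lemma ev_subst (a b : A) s t F : ev a b (subst s t F) = ev (ev a b s) (ev a b t) F.
Proof.
elim/bipoly_ind: F => [F G HF HG|k i l].
  by rewrite [subst _ _ _]rmorphD /= !evD HF HG.
rewrite subst_bimono bimonoE !evM !evC !horner_algC.
by rewrite ![ev _ _ (_ ^+ _)]rmorphXn /= evX evC horner_algX.
Qed.

Lemma laurent_shear j l f N F : laurent f N F ->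
  laurent (shear j l f) N (subst 'X ('X%:P + l%:P%:P * 'X^(j.+1)) F).
Proof.
rewrite /laurent => fF; rewrite ev_subst evX evD evM !evC evXn horner_algX horner_algC.
rewrite mulr_algl -shear_z -{2}(shear_y j l) -automorphism_ev -fF.
by rewrite endoM endoX shear_y.
Qed.

Lemma pure_x (U V : {poly {poly C}}) e : size U`_e = 1%N ->
  (e < size U)%N /\ (laurent_nf U V (size U))`_(size U - e)`_(n * e) != 0.
Proof.
move=> Ue; have eU : (e < size U)%N.
  rewrite ltnNge; apply/negP => le; move: Ue.
  by rewrite nth_default // size_poly0.
split=> //; rewrite coef_laurent_nf leq_subr subKn ?(ltnW eU) //.
have /size_poly1P[k k0 ->] : size U`_e == 1%N by rewrite Ue.
rewrite coefMC mulf_neq0 //.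
have -> : (n * e)%N = (size (p ^+ e)).-1 by rewrite size_exp.
by rewrite -lead_coefE lead_coef_eq0 expf_neq0 // p_neq0.
Qed.

Lemma pure_y (U V : {poly {poly C}}) e : size V`_e = 1%N ->
  (laurent_nf U V (size U))`_(size U + e.+1)`_0 != 0.
Proof.
move=> Ve; rewrite coef_laurent_nf ifF; last by lia.
rewrite (_ : (size U + e.+1 - (size U).+1)%N = e); last by lia.
by have /size_poly1P[k k0 ->] : size V`_e == 1%N; rewrite ?Ve // coefC.
Qed.

(** The weights b = n i0 and c = i0 + k0 + 1 give x^i0 and y^(k0+1) the same
    weight W = n i0 (k0+1), which is the top weight by [vertex_bound].  Here
    deg P = n i0, and each root multiplicity mu satisfies
    W < c mu <= 2 (k0+1) mu, so there is a single root l.  It is not 0, since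
    y^(k0+1) gives a constant term.  Then P has a linear term too: some
    y^r z, r an integer, has weight W, so b divides c, say c = b (j+1).  The shear
    z |-> z + l y^(j+1) is homogeneous and turns P into a multiple of xi^(n i0);
    the top weight is unchanged, but y^(k0+1) has disappeared. *)
Lemma shear_step f (U V : {poly {poly C}}) i0 k0 : f = ev x z U + y * ev y z V -> f != 0 ->
  LND (ham f) -> (forall e, size U`_e = 1%N -> (e <= i0)%N) ->
  (forall e, size V`_e = 1%N -> (e <= k0)%N) ->
  (0 < i0)%N -> (i0 <= k0.+1)%N -> size U`_i0 = 1%N -> size V`_k0 = 1%N ->
  exists j l, forall U1 V1, shear j l f = ev x z U1 + y * ev y z V1 ->
    (forall e, size U1`_e = 1%N -> (e <= i0)%N) /\
    (forall e, size V1`_e = 1%N -> (e < k0)%N).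
Proof.
move=> fE f0 LNDf pU pV i0_gt0 i0k0 Ui0 Vk0.
pose b := (n * i0)%N; pose c := (i0 + k0.+1)%N.
have n0 : (0 < n)%N by rewrite -ltnS prednK // ltnW.
have b0 : (0 < b)%N by rewrite muln_gt0 n0.
have c0 : (0 < c)%N by rewrite addn_gt0 i0_gt0.
have bcn : (b < c * n)%N by rewrite /b /c; nia.
have cnb : (c * n - b = n * k0.+1)%N by rewrite /b /c; nia.
have [symf P0] := top_symbol fE f0 c b0.
have pV' e : size V`_e = 1%N -> (e < k0.+1)%N by rewrite ltnS; exact: pV.
have [mle sP] := vertex_bound fE f0 LNDf pU pV' b0 c0 bcn.
set N := size U in symf P0 mle sP *; set F := laurent_nf U V N in symf P0 mle sP *.
set m := (size (wt b c F)).-1 in symf P0 mle sP *.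
set P := (wt b c F)`_m in symf P0 sP *.
have [i0N Fi0] := pure_x V Ui0; have Fk0 := pure_y U Vk0.
rewrite -/N -/F in i0N Fi0 Fk0.
have mE : m = (b * N + n * i0 * k0.+1)%N.
  apply/eqP; rewrite eqn_leq; apply/andP; split.
    apply: (leq_trans mle); rewrite cnb leq_add2l geq_max; apply/andP; split; nia.
  by apply: leq_trans (coef_le_size_wt c b0 Fi0); rewrite /b /c; nia.
have {mle} sPE : size P = (n * i0).+1.
  apply/eqP; rewrite eqn_leq sP ltnNge; apply/negP => le; case/eqP: Fi0.
  rewrite -(coef_wt c b0 F); have -> : (b * (N - i0) + c * (n * i0) = m)%N.
    by rewrite mE /b /c; nia.
  by rewrite -/P nth_default.
have WE : m%:Z - (b * N)%:Z = (n * i0 * k0.+1)%:Z by rewrite mE; lia.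
rewrite WE in symf.
have [|l [k [k_neq0 PE]]] := single_root sPE b0.
  move=> a d Pa; have := root_multiplicity b0 c0 LNDf symf Pa.
  rewrite ltz_nat => H; rewrite -(ltn_pmul2r (m := k0.+1)) //; apply: leq_trans H _.
  by rewrite /c -muln2 mulnAC [(_ * d.+1)%N]mulnC -mulnA leq_mul2l; lia.
have l0 : l != 0.
  apply: contraNneq Fk0 => l0; rewrite -(coef_wt c b0 F) muln0 addn0.
  have -> : (b * (N + k0.+1) = m)%N by rewrite mE mulnDr.
  by rewrite -/P PE l0 subr0 coefZ coefXn -/b (ltn_eqF b0) mulr0.
have P1 : P`_1 != 0.
  have -> : P`_1 = P^`()`_0 by rewrite coef_deriv mulr1n.
  rewrite PE derivZ deriv_exp derivXsubC mul1r -horner_coef0 hornerZ hornerMn.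
  rewrite horner_exp hornerXsubC sub0r mulf_neq0 // mulrn_eq0 expf_eq0 oppr_eq0.
  by rewrite (negbTE l0) andbF orbF -lt0n.
have [r [+ _]] := coef_wt_neq0 b0 P1; rewrite mE muln1 => cE.
have [j cbj] : exists j, c = (b * j.+1)%N.
  have {}cE : (b * (N + k0.+1) = b * r + c)%N by rewrite mulnDr.
  have r_lt : (r < N + k0.+1)%N.
    by rewrite -(ltn_pmul2l b0) cE -[X in (X < _)%N]addn0 ltn_add2l.
  by exists (N + k0.+1 - r).-1; rewrite prednK ?subn_gt0 // mulnBr cE addKn.
exists j, l => U1 V1 f1E.
have lf1 := laurent_shear j l (laurent_nfP V (leqnSn (size U))).
rewrite -fE -/N -/F in lf1; set F1 := subst _ _ _ in lf1.
have F1m i : (wt b c F1)`_i = (wt b c F)`_i \Po ('X + l%:P) by apply: wt_shift.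
have symf1 : symbol b c (shear j l f) (n * i0 * k0.+1)%:Z (k *: 'X^b).
  rewrite -WE; have -> : k *: 'X^b = (wt b c F1)`_m.
    rewrite F1m -/P PE comp_polyZ; congr (_ *: _).
    by rewrite rmorphXn /= comp_polyB comp_polyX comp_polyC addrK.
  apply: symbol_laurent => //; apply/leq_sizeP => i mi.
  rewrite F1m nth_default ?comp_poly0 //.
  by apply: leq_trans mi; rewrite /m; case: (size _).
have f10 : shear j l f != 0.
  apply: contraNneq f0 => /(congr1 (shear j (- l))).
  by rewrite shearK [shear _ _ 0]rmorph0 => ->.
have [symf1' P10] := top_symbol f1E f10 c b0.
have [] := symbol_uniq b0 symf1 symf1'; rewrite // ?scaler_eq0 ?negb_or ?k_neq0.
  by rewrite -size_poly_eq0 size_polyXn.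
set m1 := (size (wt b c _)).-1 => W1 P1E.
have {}W1 : m1 = (b * size U1 + b * k0.+1)%N.
  by move/eqP: W1; rewrite eq_sym subr_eq -PoszD eqz_nat => /eqP ->; rewrite addnC.
split=> e He.
  have [eN1 Fe] := pure_x V1 He.
  have := coef_le_size_wt c b0 Fe; rewrite -/m1 W1 (mulnA c).
  rewrite -(subnK (ltnW bcn)) cnb mulnDl addnCA -mulnDr subnK ?(ltnW eN1) //.
  by rewrite addnC leq_add2l /b mulnAC leq_pmul2r // leq_pmul2l.
have Fe := pure_y U1 He.
have ek0 : (e <= k0)%N.
  have := coef_le_size_wt c b0 Fe; rewrite -/m1 W1 muln0 addn0 mulnDr leq_add2l.
  by rewrite leq_pmul2l.
rewrite ltn_neqAle ek0 andbT; apply/eqP => e_k0; case/eqP: Fe.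
rewrite -(coef_wt c b0) e_k0.
have -> : (b * (size U1 + k0.+1) + c * 0 = m1)%N by rewrite W1 muln0 addn0 mulnDr.
by rewrite -P1E coefZ coefXn eq_sym (negbTE (lt0n_neq0 b0)) mulr0.
Qed.

(** For the weights 1 of y and k0+2 of z the bound of [vertex_bound] is k0,
    while z and x have larger weights; so f is a polynomial in y. *)
Lemma no_pure_x_admissible f (U V : {poly {poly C}}) k0 :
  f = ev x z U + y * ev y z V -> LND (ham f) ->
  (forall e, size U`_e = 1%N -> e = 0%N) ->
  (forall e, size V`_e = 1%N -> (e < k0)%N) -> admissible f.
Proof.
move=> fE LNDf pU pV; have [->|f0] := eqVneq f 0; first exact: admissible0.
have n0 : (0 < n)%N by rewrite -ltnS prednK // ltnW.
have pU' e : size U`_e = 1%N -> (e <= 0)%N by move=> /pU ->.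
have bcn : (1 < k0.+2 * n)%N by nia.
have [mle _] := vertex_bound fE f0 LNDf pU' pV (ltn0Sn 0) (ltn0Sn k0.+1) bcn.
rewrite muln0 max0n !mul1n in mle.
have Fle l k : (laurent_nf U V (size U))`_l`_k != 0 ->
    (l + k0.+2 * k <= size U + k0)%N.
  by move=> /(coef_le_size_wt k0.+2 (ltn0Sn 0)) H; rewrite -[l]mul1n (leq_trans H).
have U_pos e : U`_e.+1 = 0.
  apply/eqP; apply/negPn/negP => Ue.
  have eU : (e.+1 < size U)%N.
    by rewrite ltnNge; apply/negP => le; rewrite nth_default ?eqxx in Ue.
  have FE : (laurent_nf U V (size U))`_(size U - e.+1) = p ^+ e.+1 * U`_e.+1.
    by rewrite coef_laurent_nf leq_subr subKn // ltnW.
  have H0 : p ^+ e.+1 * U`_e.+1 != 0 by rewrite mulf_neq0 // expf_neq0 // p_neq0.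
  have sE : (n * e.+1 <= (size (p ^+ e.+1 * U`_e.+1)%R).-1)%N.
    rewrite -size_exp -!subn1 leq_sub2r // dvdp_leq //.
    exact: dvdp_mulIl.
  have := Fle (size U - e.+1)%N (size (p ^+ e.+1 * U`_e.+1)).-1.
  rewrite FE -lead_coefE lead_coef_eq0 => /(_ H0).
  apply/negP; rewrite -ltnNge.
  have : (k0.+2 * (n * e.+1) <= k0.+2 * (size (p ^+ e.+1 * U`_e.+1)%R).-1)%N.
    by rewrite leq_mul2l sE orbT.
  by nia.
have UE : U = ((U`_0)`_0)%:P%:P.
  apply/polyP => -[|e]; rewrite coefC //=; apply/polyP => -[|k]; rewrite coefC //=.
  apply/eqP; apply/negPn/negP => Uk; have := Fle (size U) k.+1.
  by rewrite coef_laurent_nf leqnn subnn expr0 mul1r => /(_ Uk); nia.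
exists 0, V, 0, (U`_0)`_0; rewrite fE {1}UE evC horner_algC ev0 !mulr0 deriv0 rmorph0.
by ring.
Qed.

(** Induction on the sum of the bounds for the pure powers of x and y. *)
Definition admissible_below s := forall f (U V : {poly {poly C}}) i0 k0,
  (i0 + k0 <= s)%N -> f = ev x z U + y * ev y z V -> LND (ham f) ->
  (forall e, size U`_e = 1%N -> (e <= i0)%N) ->
  (forall e, size V`_e = 1%N -> (e < k0)%N) -> admissible f.

Lemma admissible_below_ordered s f (U V : {poly {poly C}}) i0 k0 : admissible_below s ->
  (i0 + k0 <= s.+1)%N -> f = ev x z U + y * ev y z V -> LND (ham f) ->
  (forall e, size U`_e = 1%N -> (e <= i0)%N) ->
  (forall e, size V`_e = 1%N -> (e < k0)%N) -> (i0 <= k0)%N -> admissible f.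
Proof.
move=> IH iks fE LNDf pU pV ik; case: i0 => [|i] in iks pU ik *.
  by apply: no_pure_x_admissible fE LNDf _ pV => e /pU; rewrite leqn0 => /eqP.
case: k0 => [//|k] in iks pV ik *.
have [Ui|Ui] := eqVneq (size U`_i.+1) 1%N; last first.
  apply: (IH f U V i k.+1) => //.
  move=> e He; rewrite -ltnS ltn_neqAle pU // andbT.
  by apply: contraNneq Ui => <-; apply/eqP.
have [Vk|Vk] := eqVneq (size V`_k) 1%N; last first.
  apply: (IH f U V i.+1 k) => //; first by lia.
  move=> e He; rewrite ltn_neqAle -ltnS pV // andbT.
  by apply: contraNneq Vk => <-; apply/eqP.
have f0 : f != 0.
  apply/eqP => f0; move: fE; rewrite f0 => /esym/nf_eq0[U0 _].
  by move: Ui; rewrite U0 coef0 size_poly0.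
have [j [l shear_pure]] := shear_step fE f0 LNDf pU pV (ltn0Sn i) ik Ui Vk.
have [U1 [V1 f1E]] := regfun_nf (shear j l f).
have [pU1 pV1] := shear_pure _ _ f1E.
have gf1 : admissible (shear j l f).
  apply: (IH _ U1 V1 i.+1 k) => //; first by lia.
  exact: shear_LND.
by rewrite -(shearK j l f); apply: shear_admissible.
Qed.

Lemma admissible_below_all s : admissible_below s.
Proof.
elim: s => [|s IH] f U V i0 k0 iks fE LNDf pU pV.
  apply: (@no_pure_x_admissible f U V k0) => // e /pU; lia.
have [ik|ki] := leqP i0 k0; first exact: (admissible_below_ordered IH iks fE LNDf pU pV ik).
(* The normal form of the swapped function: the part of U in C[z] stays with the
   powers of x. *)
have [r [U' UE]] : exists r U', U = r%:P + 'X * U'.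
  elim/poly_ind: (U) => [|U' r _]; first by exists 0, 0; rewrite mulr0 addr0.
  by exists r, U'; rewrite mulrC addrC.
apply: swap_admissible.
apply: (@admissible_below_ordered s (swap f) (r%:P + 'X * V) U' k0 i0) => //.
- by rewrite addnC.
- rewrite fE endoD endoM !automorphism_ev swap_x swap_y swap_z UE.
  by rewrite !evD !evM !evX !evC; ring.
- exact: swap_LND.
- move=> [|e]; rewrite coefD coefC coefXM /= ?add0r //; exact: pV.
- move=> e He; apply: pU; by rewrite UE coefD coefC coefXM /= add0r.
- exact: ltnW.
Qed.

Lemma LND_admissible f : LND (ham f) -> admissible f.
Proof.
move=> LNDf; have [U [V fE]] := regfun_nf f.
have small (W : {poly {poly C}}) e : size W`_e = 1%N -> (e < size W)%N.
  by move=> We; rewrite ltnNge; apply/negP => le; rewrite nth_default ?size_poly0 in We.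
apply: (admissible_below_all (leqnn _) fE LNDf) => e He; last exact: small He.
exact: ltnW (small _ _ He).
Qed.

(** * The fields of pure powers are locally nilpotent *)

Section Nilpotency.
Variables (D : A -> A) (DD : derivation D).

Definition nilpotent_at g := exists N, iter N D g = 0.

Lemma nilpotentD g h : nilpotent_at g -> nilpotent_at h -> nilpotent_at (g + h).
Proof.
move=> [N gN] [M hM]; exists (N + M)%N; rewrite (iter_morphD (derD DD)).
by rewrite {1}addnC !iterD gN hM !(iter_morph0 (derD DD)) addr0.
Qed.

Lemma nilpotentM g h : nilpotent_at g -> nilpotent_at h -> nilpotent_at (g * h).
Proof.
move=> [N gN] [M hM]; exists (N + M)%N.
exact: (iter_leibniz_eq0 (derD DD) (@mul0r A) (@mulr0 A) (derM DD) gN hM).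
Qed.

Lemma nilpotentC c : nilpotent_at c%:A.
Proof. by exists 1%N; rewrite /= (derC DD). Qed.

Lemma nilpotent_pol g r : nilpotent_at g -> nilpotent_at (horner_alg g r).
Proof.
move=> ng; elim/poly_ind: r => [|r c IH]; first by exists 0%N; rewrite rmorph0.
rewrite rmorphD rmorphM /= horner_algX horner_algC.
by apply: nilpotentD; [exact: nilpotentM|exact: nilpotentC].
Qed.

Lemma LND_of_generators : nilpotent_at x -> nilpotent_at y -> nilpotent_at z ->
  LND D.
Proof.
move=> nx ny nz; split=> //.
by apply: regfun_ind => //; [exact: nilpotentC|exact: nilpotentD|exact: nilpotentM].
Qed.
End Nilpotency.

(** {x^i, .} kills x, and {x^i, z} is in C[x]; so it is nilpotent at z, and
    therefore at {x^i, y}, which lies in C[x, z]. *)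
Lemma LND_x i : LND (ham (x ^+ i)).
Proof.
have DD := ham_der (x ^+ i); set D := ham (x ^+ i) in DD *.
have Dx : D x = 0 by rewrite /D (derX (ham_derl x)) /= ham_self mulr0 mul0rn.
have nX k : nilpotent_at D (x ^+ k).
  by exists 1%N; rewrite /= (derX DD) Dx mulr0 mul0rn.
have nz : nilpotent_at D z.
  exists 2%N; rewrite /= /D (derX (ham_derl z)) /= -/D ham_of_x dxz.
  by rewrite -scaler_nat (derZ DD) mulrN -exprSr (derN DD) (derX DD) Dx mulr0
    mul0rn oppr0 scaler0.
apply: (LND_of_generators DD) => //; first exact: (nX 1%N).
have [N yN] : nilpotent_at D (D y).
  have -> : D y = (- (i%:R))%:A * x ^+ i.-1 * pz p^`().
    rewrite /D ham_y (derX ddy) dyx mulr_algl scaleNr scaler_nat; ring.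
  apply: (nilpotentM DD); last exact: nilpotent_pol.
  by apply: (nilpotentM DD) => //; exact: nilpotentC.
by exists N.+1; rewrite iterSr.
Qed.

Lemma LND_y i : LND (ham (y ^+ i)).
Proof. by rewrite -swap_x -endoX; apply: swap_LND; exact: LND_x. Qed.

(** * The Lie algebra generated by the LNDs *)

Section GeneratedLieAlgebra.
Variable L : set (A -> A).
Hypotheses (Llie : lie_closed L) (Lgen : forall D, LND D -> L D).

Definition inL f := L (ham f).

Lemma inL_lin c f g : inL f -> inL g -> inL (c *: f + g).
Proof.
rewrite /inL => Lf Lg; have [_ Llin _] := Llie.
have -> : ham (c *: f + g) = c *: ham f + ham g.
  by apply/funext => h; exact: (der_lin (ham_derl h)).
exact: Llin.
Qed.

Lemma inL_0 : inL 0.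
Proof.
rewrite /inL; have [L0 _ _] := Llie.
have -> : ham 0 = 0 by apply/funext => h; exact: (der0 (ham_derl h)).
exact: L0.
Qed.

Lemma inL_D f g : inL f -> inL g -> inL (f + g).
Proof. by move=> Lf Lg; rewrite -[f]scale1r; exact: inL_lin. Qed.

Lemma inL_Z c f : inL f -> inL (c *: f).
Proof. by move=> Lf; rewrite -[_ *: _]addr0; apply: inL_lin Lf inL_0. Qed.

Lemma inL_ham f g : inL f -> inL g -> inL (ham f g).
Proof.
by rewrite /inL ham_bracket; case: Llie => _ _ Lbr Lf Lg; exact: Lbr.
Qed.

Lemma inL_unscale c f : c != 0 -> inL (c *: f) -> inL f.
Proof. by move=> c0 /(inL_Z c^-1); rewrite scalerA mulVf // scale1r. Qed.

Lemma inL_C c : inL c%:A.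
Proof.
by apply: inL_Z; rewrite /inL -[1](expr0 x); apply: Lgen; exact: LND_x.
Qed.

(** The roles of x and y are symmetric up to the sign of the bracket;
    (X, Y, e) is (x, y, 1) or (y, x, -1). *)
Section OneSide.
Variables (X Y : A) (e : C).
Hypotheses (e0 : e != 0) (XY : X * Y = pz p).
Hypotheses (ham_zX : ham z X = e *: X) (ham_zY : ham z Y = - (e *: Y)).
Hypothesis ham_YX : ham Y X = e *: pz p^`().
Hypotheses (LX : forall i, inL (X ^+ i)) (LY : forall i, inL (Y ^+ i)).

(** For each m the polynomials a with X^m a(z) in the Lie algebra form a subspace,
    which is to be shown to be everything. *)
Definition V m a := inL (X ^+ m * pz a).

Lemma V_0 m : V m 0.
Proof. by rewrite /V rmorph0 mulr0; exact: inL_0. Qed.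

Lemma V_lin m c a b : V m a -> V m b -> V m (c *: a + b).
Proof. by rewrite /V pzD pzZ mulrDr -scalerAr; exact: inL_lin. Qed.

Lemma V_Z m c a : V m a -> V m (c *: a).
Proof. by rewrite /V pzZ -scalerAr; exact: inL_Z. Qed.

Lemma V_D m a b : V m a -> V m b -> V m (a + b).
Proof. by rewrite /V pzD mulrDr; exact: inL_D. Qed.

Lemma ham_XX i k a : ham (X ^+ i * pz a) (X ^+ k)
  = (e * k%:R) *: (X ^+ (i + k) * pz a^`()).
Proof.
rewrite (derX (ham_der _)) (derM (ham_derl X)) (derX (ham_derl X)) (der_pol (ham_derl X)) /=.
rewrite ham_self mulr0 mul0rn mul0r add0r ham_zX -scalerA scaler_nat !scale_pz exprD.
by case: k => [|k]; rewrite ?mulr0n ?mulr0 //= exprS; ring.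
Qed.

Lemma pz_nat k : pz (k%:R)%:P = k%:R :> A.
Proof. by rewrite horner_algC scaler_nat. Qed.

Lemma ham_XY m l a b : ham (X ^+ (m + l.+1) * pz a) (Y ^+ l.+1 * pz b)
  = - e *: (X ^+ m * pz (p ^+ l * (((m + l.+1) * l.+1)%:R *: (p^`() * a * b)
      + (m + l.+1)%:R *: (p * a * b^`()) + l.+1%:R *: (p * a^`() * b)))).
Proof.
have ham_XtoY : ham X Y = - (e *: pz p^`()) by rewrite ham_anti ham_YX.
have ham_Xz : ham X z = - (e *: X) by rewrite ham_anti ham_zX.
rewrite (derM (ham_der _)) (derX (ham_der _)) (der_pol (ham_der _)).
rewrite !(derM (ham_derl _)) !(derX (ham_derl _)) !(der_pol (ham_derl _)) /=.
rewrite ham_XtoY ham_Xz ham_self ham_zY !addnS /= pzM !pzD !pzZ !pzM [pz (_ ^+ _)]rmorphXn /=.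
rewrite -XY exprMn !scale_pz !exprS exprD !polyCN !pz_nat [pz (- _)]rmorphN /=.
move: (pz e%:P) (pz p^`()) (pz a) (pz b) (pz a^`()) (pz b^`()) (X ^+ m) (X ^+ l) (Y ^+ l).
by move=> E p' a0 b0 a' b' Xm Xl Yl; ring.
Qed.

(** {X^i a(z), X^k} is a multiple of X^(i+k) a'(z). *)
Lemma V_deriv i k a : V i a -> V (i + k.+1) a^`().
Proof.
move=> Va; have ek : e * k.+1%:R != 0 by rewrite mulf_neq0 ?pnatr_eq0.
apply: (inL_unscale ek); rewrite -ham_XX; apply: inL_ham => //; exact: LX.
Qed.

Lemma V_XY m l a b : V (m + l.+1) a -> inL (Y ^+ l.+1 * pz b) ->
  V m (p ^+ l * (((m + l.+1) * l.+1)%:R *: (p^`() * a * b)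
      + (m + l.+1)%:R *: (p * a * b^`()) + l.+1%:R *: (p * a^`() * b))).
Proof.
move=> Va Yb; have ne : - e != 0 by rewrite oppr_eq0.
by apply: (inL_unscale ne); rewrite -ham_XY; exact: inL_ham.
Qed.

Lemma inL_XY a b : inL (X * pz a) -> inL (Y * pz b) -> inL (pz (p * (a * b))^`()).
Proof.
move=> Xa Yb; have := @V_XY 0 0 a b; rewrite /V !expr1 => /(_ Xa Yb).
rewrite !expr0 !mul1r !mul1n !scale1r; congr (inL (pz _)).
by rewrite !derivM; ring.
Qed.

Lemma V_1 i : V i 1.
Proof. by rewrite /V rmorph1 mulr1; exact: LX. Qed.

Lemma Y_1 i : inL (Y ^+ i * pz 1).
Proof. by rewrite rmorph1 mulr1; exact: LY. Qed.

Lemma V_pow m l : V m (p ^+ l * p^`()).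
Proof.
have := V_XY (V_1 (m + l.+1)) (Y_1 l.+1).
rewrite derivC !mulr0 !mul0r !scaler0 !addr0 !mulr1 -scalerAr /V pzZ -scalerAr.
by apply: inL_unscale; rewrite pnatr_eq0 muln_eq0 addnS.
Qed.

Lemma V_derivn m l r : (r <= m)%N -> V m (p ^+ l * p^`())^`(r).
Proof.
elim: r m => [|r IH] [|m] //; [by move=> _; exact: V_pow|by move=> _; exact: V_pow|].
by rewrite ltnS derivnS -addn1 => rm; apply: V_deriv; exact: IH.
Qed.

(** The r-th derivative of p^l p' has degree n l + n - 1 - r.  With r < n, which
    [V_derivn] permits as m >= n, this takes every value. *)
Lemma V_full_large m : (n <= m)%N -> forall a, V m a.
Proof.
move=> nm; apply: poly_subspace_full => [|c a b|d]; [exact: V_0|exact: V_lin|].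
have n0 : (0 < n)%N by rewrite -ltnS prednK // ltnW.
exists (p ^+ (d %/ n) * p^`())^`(n.-1 - d %% n); first by apply: V_derivn; lia.
have p'0 : p^`() != 0 by rewrite -size_poly_gt0 size_deriv_char0.
have pd : (0 < size (p ^+ (d %/ n))%R)%N by rewrite size_poly_gt0 expf_neq0 // p_neq0.
rewrite size_derivn size_mul ?expf_neq0 ?p_neq0 // size_deriv_char0.
rewrite -(prednK pd) size_exp addSn /=.
have := ltn_pmod d n0; have := divn_eq d n.
move: (d %/ n)%N (d %% n)%N => k r; rewrite [(k * _)%N]mulnC.
move: n n0 => N N0; move: (N * k)%N => t; lia.
Qed.

Hypothesis Y_large : forall l b, (n <= l)%N -> inL (Y ^+ l * pz b).

(** Descending induction on m, from [V_full_large]; all X^(m+k) a(z) with k > 0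
    are at hand.  The brackets of X^(m+n) c with Y^n z and of X^(m+n) c z with
    Y^n differ by m X^m p^n c, up to a nonzero factor.  So X^m p^n c is reached
    for all c.  Then the power of p is lowered step by step: the bracket of
    X^(m+r+1) a with Y^(r+1) is a multiple of X^m p^r p' a, up to terms with
    p^(r+1), and p' is invertible modulo p. *)
Lemma V_full m a : (0 < m)%N -> V m a.
Proof.
have n0 : (0 < n)%N by rewrite -ltnS prednK // ltnW.
have [t] := ubnP (n - m); elim: t m a => // t IH m a; rewrite ltnS => nmt m0.
have [nm|mn] := leqP n m; first exact: V_full_large.
have Vbig l c : V (m + l.+1) c by apply: IH; lia.
have Vpn c : V m (p ^+ n * c).
  have [k nE] : exists k, n = k.+1 by exists n.-1; rewrite prednK.
  have Yk : inL (Y ^+ k.+1 * pz 'X) by apply: Y_large; rewrite nE.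
  have H1 := V_XY (Vbig k c) Yk; have H2 := V_XY (Vbig k (c * 'X)) (Y_1 k.+1).
  have := V_D H1 (V_Z (-1) H2); rewrite nE derivM derivX derivC.
  set g := (X in V m X); have -> : g = m%:R *: (p ^+ k.+1 * c).
    by rewrite /g -!mul_polyC !polyC_natr polyCN polyC1 exprS; ring.
  by rewrite /V pzZ -scalerAr; apply: inL_unscale; rewrite pnatr_eq0 -lt0n.
have Vpl l : (l <= n)%N -> forall c, V m (p ^+ (n - l) * c).
  elim: l => [|l IHl] ln c; first by rewrite subn0.
  have {}IHl := IHl (ltnW ln); set r := (n - l.+1)%N.
  have rE : (n - l)%N = r.+1 by rewrite /r; lia.
  rewrite rE in IHl.
  (* c = c bv p' + c bu p; the first summand is the main term of the bracket for
     a = c1, and the second one gives a multiple of p^(r+1). *)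
  pose k1 : C := ((m + r.+1) * r.+1)%:R.
  have k10 : k1 != 0 by rewrite pnatr_eq0 muln_eq0 addnS.
  pose c1 := k1^-1 *: (c * bv).
  have := V_XY (Vbig r c1) (Y_1 r.+1).
  rewrite derivC !mulr0 scaler0 addr0 !mulr1 -/k1 => H.
  have H' := IHl (- (r.+1%:R *: c1^`()) + c * bu).
  have := V_D H H'; congr (V m _).
  rewrite -[c in RHS]mulr1 -bezout_p /c1 exprSr -scalerAr scalerA mulfV // scale1r.
  by rewrite -!mul_polyC; ring.
by have := Vpl n (leqnn n) a; rewrite subnn expr0 mul1r.
Qed.
End OneSide.

Lemma inL_admissible f : admissible f -> inL f.
Proof.
have e1 : (1 : C) != 0 := oner_neq0 C.
have e2 : (-1 : C) != 0 by rewrite oppr_eq0 oner_neq0.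
have xy : x * y = pz p := regxy p.
have yx : y * x = pz p by rewrite mulrC.
have Jx1 : ham z x = 1 *: x by rewrite scale1r ham_zx.
have Jx2 : ham z x = - (-1 *: x) by rewrite scaleN1r opprK ham_zx.
have Jy1 : ham z y = - (1 *: y) by rewrite scale1r ham_zy.
have Jy2 : ham z y = -1 *: y by rewrite scaleN1r ham_zy.
have Jyx1 : ham y x = 1 *: pz p^`() by rewrite scale1r ham_yx.
have Jxy2 : ham x y = -1 *: pz p^`() by rewrite scaleN1r ham_anti ham_yx.
have Lx i : inL (x ^+ i) by apply: Lgen; exact: LND_x.
have Ly i : inL (y ^+ i) by apply: Lgen; exact: LND_y.
have xlarge l b : (n <= l)%N -> inL (x ^+ l * pz b).
  by move=> nl; apply: (@V_full_large x y 1).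
have ylarge l b : (n <= l)%N -> inL (y ^+ l * pz b).
  by move=> nl; apply: (@V_full_large y x (-1)).
have xall m a : (0 < m)%N -> inL (x ^+ m * pz a).
  by move=> m0; apply: (@V_full x y 1).
have yall m a : (0 < m)%N -> inL (y ^+ m * pz a).
  by move=> m0; apply: (@V_full y x (-1)).
move: f; apply: admissible_ind => [f g|i r|i r|q|c].
- exact: inL_D.
- exact: xall.
- exact: yall.
- rewrite -[q]mulr1; apply: (@inL_XY x y 1) => //.
    by rewrite -[x]expr1; exact: xall.
  by rewrite -[y]expr1; exact: yall.
- exact: inL_C.
Qed.
End GeneratedLieAlgebra.

(** The fields of admissible functions form a Lie algebra that contains the
    LNDs; conversely every Lie algebra that contains the LNDs contains these
    fields. *)
Lemma admissible_generated f : admissible f <-> lie_combination (@LND C p) (ham f).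
Proof.
split=> [gf L [Llie Lgen]|]; first exact: (inL_admissible Llie Lgen gf).
pose S : set (A -> A) := fun D => exists2 g, admissible g & D = ham g.
move=> /(_ S) Sf; have [g gg JE] : S (ham f).
  apply: Sf; split=> [|D DL]; last first.
    have [g DE] := LND_hamiltonian DL; exists g => //.
    by apply: LND_admissible; rewrite -DE.
  split=> [|c D E [g gg ->] [h gh ->]|D E [g gg ->] [h gh ->]].
  - exists 0; first exact: admissible0.
    by apply/funext => h; rewrite (der0 (ham_derl h)).
  - exists (c *: g + h); first by apply: admissibleD => //; exact: admissibleZ.
    by apply/funext => k; rewrite (der_lin (ham_derl k)).
  - by exists (ham g h); [exact: admissible_ham|rewrite ham_bracket].
have [c Ec] : exists c, f - g = c%:A.
  by apply: ham_eq0_const; apply/funext => h; rewrite (derB (ham_derl h)) JE subrr.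
by rewrite -[f](subrK g) Ec; apply: admissibleD => //; exact: admissible_C.
Qed.

Lemma admissible_form f : admissible f <-> exists (k k' l l' : nat) (a b : nat -> nat -> C)
    (q : {poly C}) (c : C),
  f = \sum_(1 <= i < k.+1) \sum_(0 <= j < k'.+1) a i j *: (x ^+ i * z ^+ j)
    + \sum_(1 <= i < l.+1) \sum_(0 <= j < l'.+1) b i j *: (y ^+ i * z ^+ j)
    + pz (p * q)^`() + c%:A.
Proof.
have zX j : z ^+ j = pz 'X^j by rewrite rmorphXn /= horner_algX.
have pzE (r : {poly C}) K : (size r <= K)%N ->
    pz r = \sum_(0 <= j < K) r`_j *: z ^+ j.
  move=> sr; have {1}-> : r = \sum_(j < K) r`_j *: 'X^j.
    rewrite -poly_def; apply/polyP => j; rewrite coef_poly; case: ltnP => // Kj.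
    by rewrite nth_default // (leq_trans sr).
  rewrite [LHS]rmorph_sum big_mkord; apply: eq_bigr => j _.
  by rewrite zX -pzZ.
have evE' w (U : {poly {poly C}}) : exists K, w * ev w z U =
    \sum_(1 <= i < (size U).+1) \sum_(0 <= j < K.+1) U`_i.-1`_j *: (w ^+ i * z ^+ j).
  exists (\max_(i < size U) size (U`_i)%R)%N; rewrite evE mulr_sumr big_add1 big_mkord /=.
  apply: eq_bigr => i _; rewrite mulrA -exprS (pzE _ (\max_(i < size U) size (U`_i)%R).+1).
    by rewrite mulr_sumr; apply: eq_bigr => j _; rewrite scalerAr.
  by apply: leqW; exact: (leq_bigmax i).
split=> [[U [V [q [c ->]]]]|[k [k' [l [l' [a [b [q [c ->]]]]]]]]].
  have [K ->] := evE' x U; have [K' ->] := evE' y V.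
  by exists (size U), K, (size V), K', (fun i j => U`_i.-1`_j), (fun i j => V`_i.-1`_j), q, c.
apply: admissibleD; last exact: admissible_C.
apply: admissibleD; last exact: admissible_pq.
apply: admissibleD.
  rewrite big_add1; apply: admissible_sum => i _; apply: admissible_sum => j _.
  by apply: admissibleZ; rewrite zX; exact: admissible_x.
rewrite big_add1; apply: admissible_sum => i _; apply: admissible_sum => j _.
by apply: admissibleZ; rewrite zX; exact: admissible_y.
Qed.

End DanielewskiSurface.

(** * The theorem *)

Lemma simple_zeros_bezout (C : closedFieldType) (p : {poly C}) :
  p != 0 -> only_simple_zeros p -> exists u v, u * p + v * p^`() = 1.
Proof.
move=> p_neq0 simple; have : coprimep p p^`().
  apply: Pdiv.ClosedField.root_coprimep => a pa; apply/negP => /eqP p'a.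
  have /factor_theorem[q pE] := pa.
  have /factor_theorem[s qE] : root q a.
    by rewrite /root -p'a pE derivM derivXsubC !hornerE subrr mulr0 add0r.
  suff : (1 < mup a p)%N by rewrite simple.
  by rewrite mup_geq // pE qE -mulrA -expr2 dvdp_mull.
by case/Bezout_eq1_coprimepP => -[u v] /= uv; exists u, v.
Qed.

Theorem theorem3p26 (R : realType) (p : {poly R[i]})
  (p_nonconstant : (1 < size p)%N) (p_simple : only_simple_zeros p)
  (omega : (regfun p -> regfun p) -> (regfun p -> regfun p) -> regfun p)
  (omega_std : standard_volume_form omega)
  (Theta : regfun p -> regfun p) (Theta_der : derivation Theta)
  (Theta_vol : volume_preserving omega Theta)
  (f : regfun p) (Theta_f : hamiltonian omega Theta f) :
  lie_combination (@LND _ p) Theta <->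
  exists (k k' l l' : nat) (a b : nat -> nat -> R[i]) (q : {poly R[i]})
    (c : R[i]),
    f = \sum_(1 <= i < k.+1) \sum_(0 <= j < k'.+1)
          a i j *: (regx p ^+ i * regz p ^+ j)
      + \sum_(1 <= i < l.+1) \sum_(0 <= j < l'.+1)
          b i j *: (regy p ^+ i * regz p ^+ j)
      + horner_alg (regz p) ((p * q)^`())
      + c%:A.
Proof.
have p_neq0 : p != 0 by rewrite -size_poly_gt0 ltnW.
have [u [v bezout_p]] := simple_zeros_bezout p_neq0 p_simple.
rewrite (hamiltonianE p_nonconstant bezout_p omega_std Theta_der Theta_f).
rewrite -(admissible_generated p_nonconstant bezout_p); exact: admissible_form.
Qed.
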